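(* Let $M\in\mathbb{N}$ with $M\ge 2$ and let $W\subset\mathbb{R}^M$ be a convex body. For each $n$ let $\xi_n\subset\mathbb{R}^M$ be a set of $n$ points chosen independently and uniformly from $W$. Then: (i) for every $k\in\mathbb{N}$ (with $k\ge 1$) there exist a constant $c>0$, not depending on $n$, and an $n_0\in\mathbb{N}$ such that $$\mathbb{E}\left[\deg(\xi_n)^k\right]\;\ge\; c\,\frac{n^k}{\log n}\qquad\text{for all } n\ge n_0;$$ (ii) $\deg(\xi_n)\to\infty$ in probability as $n\to\infty$, i.e. for every $t>0$, $\mathbb{P}(\deg(\xi_n)\le t)\to 0$ as $n\to\infty$.
   Context: A convex body is a compact convex set with nonempty interior. A finite set $X\subset\mathbb{R}^M$ is in general position if no $M+1$ of its points lie in an affine hyperplane; with probability one, $n$ independent uniform points of a convex body are distinct and in general position. For a finite set $X\subset\mathbb{R}^M$ in general position and an $(M+1)$-element subset $\{x_1,\dots,x_{M+1}\}\subset X$, the $M$-simplex $\operatorname{conv}\{x_1,\dots,x_{M+1}\}$ is called empty (in $X$) if $\operatorname{conv}\{x_1,\dots,x_{M+1}\}\cap X=\{x_1,\dots,x_{M+1}\}$. For an $M$-element subset $\{x_1,\dots,x_M\}\subset X$, its degree $\deg(x_1,\dots,x_M)$ is the number of points $z\in X\setminus\{x_1,\dots,x_M\}$ such that $\operatorname{conv}\{x_1,\dots,x_M,z\}$ is empty in $X$. The degree of $X$ is $$\deg(X)=\max\left\{\deg(x_1,\dots,x_M): \{x_1,\dots,x_M\}\subset X,\ |\{x_1,\dots,x_M\}|=M\right\}.$$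 *)

(* Defs.v *)
From HB Require Import structures.
From mathcomp Require Import all_boot all_order all_algebra finmap.
From mathcomp Require Import all_classical all_reals all_analysis.
Set Implicit Arguments.
Unset Strict Implicit.
Unset Printing Implicit Defensive.
Import Order.TTheory GRing.Theory Num.Theory.
Import numFieldNormedType.Exports.
Local Open Scope classical_set_scope.
Local Open Scope ring_scope.

Section Convex.
Context {R : realType} {M : nat}.
Implicit Types (W : set 'rV[R]_M) (X S : {fset 'rV[R]_M}).

Definition convex_body W : Prop :=
  [/\ compact W, convex_set W & W° !=set0].

Definition conv_hull (A : set 'rV[R]_M) : set 'rV[R]_M :=
  smallest (fun C : set 'rV[R]_M => convex_set C) A.

(* [empty_in], [degree_of] and [degree] are total: they are given by the usual
   formulas for every finite set, whether or not it is in general position. *)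
Definition empty_in X S : Prop :=
  conv_hull [set` S] `&` [set` X] = [set` S].

Definition degree_of X S : nat :=
  #|` [fset z in X `\` S | `[< empty_in X (z |` S) >]]%fset |.

Definition degree X : nat :=
  \max_(S <- fpowerset X | #|` S|%fset == M) degree_of X S.

End Convex.

(* R^M with its Borel sigma-algebra *)
Definition borel_rV (R : realType) (M : nat) :=
  g_sigma_algebraType (@open 'rV[R]_M).

(* M-dimensional Lebesgue measure as an iterated integral over the coordinates
   (the recursion peels off the first one); meaningful on Borel sets. *)
Fixpoint lebesgue_rV (R : realType) (M : nat) : set 'rV[R]_M -> \bar R :=
  match M with
  | 0 => fun A => (\1_A (0 : 'rV[R]_0))%:E
  | m.+1 => fun A =>
      (\int[lebesgue_measure]_x
        lebesgue_rV [set v : 'rV[R]_m | A (row_mx x%:M v)])%E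
  end.

Lemma lebesgue_rV0 (R : realType) (M : nat) : lebesgue_rV (@set0 'rV[R]_M) = 0%E.
Proof.
elim: M => [|M IH] /=; first by rewrite indic0.
by under eq_integral do rewrite IH; rewrite integral0.
Qed.

Lemma lebesgue_rV_box (R : realType) (M : nat) (a b : 'rV[R]_M) :
  (forall i, a ord0 i <= b ord0 i) ->
  lebesgue_rV [set v : 'rV[R]_M | forall i, a ord0 i <= v ord0 i <= b ord0 i] =
  (\prod_(i < M) (b ord0 i - a ord0 i))%:E.
Proof.
elim: M a b => [|M IH] a b ab.
  by rewrite /= indicE mem_set ?big_ord0//; case.
pose a' : 'rV[R]_M := \row_j a ord0 (lift ord0 j).
pose b' : 'rV[R]_M := \row_j b ord0 (lift ord0 j).
have r0 (x : R) (v : 'rV[R]_M) :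
    (row_mx x%:M v : 'rV[R]_(M.+1)) ord0 ord0 = x.
  rewrite (_ : ord0 = lshift M (ord0 : 'I_1)); last exact: val_inj.
  by rewrite (row_mxEl (x%:M : 'M[R]_1)) mxE.
have rS (x : R) (v : 'rV[R]_M) j :
    (row_mx x%:M v : 'rV[R]_(M.+1)) ord0 (lift ord0 j) = v ord0 j.
  rewrite (_ : lift ord0 j = rshift 1 j); last exact: val_inj.
  by rewrite (row_mxEr (x%:M : 'M[R]_1)).
have sec (x : R) : [set v : 'rV[R]_M |
      forall i, a ord0 i <= (row_mx x%:M v : 'rV[R]_(M.+1)) ord0 i <= b ord0 i] =
    if x \in `[a ord0 ord0, b ord0 ord0]%R then
      [set v : 'rV[R]_M | forall i, a' ord0 i <= v ord0 i <= b' ord0 i]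
    else set0.
  apply/seteqP; split => v /=.
    move=> h; have := h ord0; rewrite r0 in_itv/= => -> i.
    by have := h (lift ord0 i); rewrite rS !mxE.
  rewrite in_itv/=; case: ifPn => // h0 h i.
  case: (unliftP ord0 i) => [j ->|->]; last by rewrite r0.
  by have := h j; rewrite rS !mxE.
have pr : \prod_(i < M) (b' ord0 i - a' ord0 i) =
    \prod_(i < M) (b ord0 (lift ord0 i) - a ord0 (lift ord0 i)).
  by apply: eq_bigr => i _; rewrite !mxE.
rewrite big_ord_recl -pr.
transitivity (\int[@lebesgue_measure R]_(x in `[a ord0 ord0, b ord0 ord0])
    (\prod_(i < M) (b' ord0 i - a' ord0 i))%:E)%E.
  rewrite [RHS]integral_mkcond; apply: eq_integral => x _.
  rewrite patchE sec mem_setE; case: ifPn => _; last exact: lebesgue_rV0.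
  by apply: IH => i; rewrite !mxE.
rewrite integral_cst//.
have /= -> := @lebesgue_measure_itv R `[a ord0 ord0, b ord0 ord0]%R.
rewrite lte_fin.
case: ltgtP (ab ord0) => // [_|->] _; first by rewrite -EFinD -EFinM mulrC.
by rewrite subrr mul0r mule0.
Qed.

Section Probability.
Context {d : measure_display} {T : measurableType d} {R : realType}.
Variables (P : probability T R) (M : nat).

Definition uniform_on (W : set 'rV[R]_M) (X : {RV P >-> borel_rV R M}) : Prop :=
  forall A : set (borel_rV R M), measurable A ->
    P (X @^-1` A) = (fine (lebesgue_rV (A `&` W)) / fine (lebesgue_rV W))%:E.

Definition mutually_independent (n : nat)
    (X : 'I_n -> {RV P >-> borel_rV R M}) : Prop :=
  forall (J : {set 'I_n}) (A : 'I_n -> set (borel_rV R M)),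
    (forall i, measurable (A i)) ->
    P (\bigcap_(i in [set` J]) X i @^-1` A i) =
    (\prod_(i in J) P (X i @^-1` A i))%E.

Definition point_set (n : nat) (X : 'I_n -> {RV P >-> borel_rV R M}) (w : T) :
  {fset 'rV[R]_M} := [fset (X i w : 'rV[R]_M) | i in 'I_n]%fset.

End Probability.

(* Main.v *)
(* M points of the sample that lie within n^(-1/(M-1)) of each other span with a
   further point z a simplex inside a thin tube of volume O(1/n), and the expected
   number of such clusters is of constant order.

   All events are expressed through the cells of a grid that contain the points,
   so that the sample becomes a product law on a finite set. A window is a block
   of cells; the windows tile a cube inside W. For a window v and an injection g
   of m indices, consider the event that v contains exactly the points g a, each
   in a prescribed cell. Counting the pairs (v, g), the second moment method
   bounds from below the probability that one of these events occurs.

   (i) Take m = M and about n^(M/(M-1)) windows: the expected count stays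
   bounded from below and, by the Markov inequality, given such an event, with
   probability at least 1/2 no more than half of the points z have a tube that
   meets the rest of the sample. So the degree is at least n / 4 with
   probability bounded from below.

   (ii) Take m = M + t and about n windows, with the prescribed cells placed so
   that the M cluster points and each of the t others form an empty simplex. The
   expected count grows linearly and different windows are almost independent,
   so the degree is at least t with probability 1 - O(1/n). *)
Require Import Defs.
From HB Require Import structures.
From mathcomp Require Import all_boot all_order all_algebra finmap.
From mathcomp Require Import all_classical all_reals all_analysis.
From mathcomp Require Import measurable_realfun zify ring lra.
Set Implicit Arguments.
Unset Strict Implicit.
Unset Printing Implicit Defensive.
Import Order.TTheory GRing.Theory Num.Theory.
Import numFieldNormedType.Exports.
Local Open Scope classical_set_scope.
Local Open Scope ring_scope.

(** * Second moment method for occupied windows *)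

Section ProductLaw.
Context {R : realFieldType} {C : finType} {n : nat} (q : C -> R).
Hypotheses (q_ge0 : forall c, 0 <= q c) (q_sum1 : \sum_c q c = 1).
Implicit Types (f : {ffun 'I_n -> C}) (E : pred {ffun 'I_n -> C}) (B : pred C).

Definition mass B : R := \sum_(c | B c) q c.

Definition weight f : R := \prod_i q (f i).

(** The law of [n] independent cells with common law [q], as a finite sum over all assignments of
    cells to points. *)
Definition pr E : R := \sum_(f | E f) weight f.

Lemma weight_ge0 f : 0 <= weight f.
Proof. exact: prodr_ge0. Qed.

Lemma mass_ge0 B : 0 <= mass B.
Proof. exact: sumr_ge0. Qed.

Lemma mass_le B1 B2 : (forall c, B1 c -> B2 c) -> mass B1 <= mass B2.
Proof.
move=> B12; rewrite /mass [leRHS]big_mkcond [leLHS]big_mkcond /=.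
apply: ler_sum => c _; case: ifP => [/B12 ->//|_]; by case: ifP.
Qed.

Lemma mass1 c : mass (pred1 c) = q c.
Proof. by rewrite /mass big_pred1_eq. Qed.

Lemma massC B : mass (predC B) = 1 - mass B.
Proof. by apply/eqP; rewrite eq_sym subr_eq -q_sum1 (bigID B) addrC. Qed.

Lemma pr_ge0 E : 0 <= pr E.
Proof. by apply: sumr_ge0 => f _; exact: weight_ge0. Qed.

Lemma pr_le E1 E2 : (forall f, E1 f -> E2 f) -> pr E1 <= pr E2.
Proof.
move=> E12; rewrite /pr [leRHS]big_mkcond [leLHS]big_mkcond /=.
apply: ler_sum => f _; case: ifP => [/E12 ->//|_].
by case: ifP => // _; exact: weight_ge0.
Qed.

Lemma eq_pr E1 E2 : E1 =1 E2 -> pr E1 = pr E2.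
Proof. by move=> E12; apply: eq_bigl. Qed.

Lemma pr_box (B : 'I_n -> pred C) :
  pr (fun f => [forall i, B i (f i)]) = \prod_i mass (B i).
Proof.
rewrite /mass bigA_distr_big_dep; apply: eq_bigl => f.
by apply/forallP/familyP => h i; have := h i.
Qed.

Lemma pr_sum E : pr E = \sum_f weight f * (E f)%:R.
Proof.
rewrite /pr big_mkcond; apply: eq_bigr => f _.
by case: (E f); rewrite ?mulr1 ?mulr0.
Qed.

Lemma pr_exists (A : finType) (E : A -> pred {ffun 'I_n -> C}) :
  pr (fun f => [exists a, E a f]) <= \sum_a pr (E a).
Proof.
under eq_bigr do rewrite pr_sum.
rewrite pr_sum exchange_big /=; apply: ler_sum => f _.
rewrite -mulr_sumr; apply: ler_wpM2l; first exact: weight_ge0.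
have [/existsP[a Ea]|_] := boolP [exists a, E a f]; last exact: sumr_ge0.
by rewrite (bigD1 a) //= Ea lerDl sumr_ge0.
Qed.

(* Second moment bound: 1 - (1 - c Y)^2 <= 1_{Y > 0}, where Y counts the events
   that occur; optimizing over c gives the Chung-Erdos inequality. *)
Lemma pr_exists_ge (A : finType) (E : A -> pred {ffun 'I_n -> C}) (c : R) :
  2 * c * (\sum_a pr (E a)) -
    c ^+ 2 * (\sum_a \sum_b pr (fun f => E a f && E b f)) <=
  pr (fun f => [exists a, E a f]).
Proof.
pose Y f : R := \sum_a (E a f)%:R.
have -> : \sum_a pr (E a) = \sum_f weight f * Y f.
  under eq_bigr do rewrite pr_sum.
  by rewrite exchange_big; apply: eq_bigr => f _; rewrite mulr_sumr.
have -> : \sum_a \sum_b pr (fun f => E a f && E b f) =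
    \sum_f weight f * Y f ^+ 2.
  transitivity (\sum_a \sum_f \sum_b weight f * (E a f && E b f)%:R).
    apply: eq_bigr => a _; under eq_bigr do rewrite pr_sum.
    by rewrite exchange_big.
  rewrite exchange_big; apply: eq_bigr => f _.
  under eq_bigr do rewrite -mulr_sumr.
  rewrite -mulr_sumr expr2 mulr_suml; congr (_ * _).
  apply: eq_bigr => a _; rewrite mulr_sumr; apply: eq_bigr => b _.
  by rewrite -mulnb natrM.
rewrite pr_sum !mulr_sumr -sumrB; apply: ler_sum => f _.
have -> : 2 * c * (weight f * Y f) - c ^+ 2 * (weight f * Y f ^+ 2) =
  weight f * (1 - (1 - c * Y f) ^+ 2) by ring.
apply: ler_wpM2l; first exact: weight_ge0.
have [_|noE] := boolP [exists a, E a f].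
  by rewrite gerBl sqr_ge0.
rewrite /Y big1 ?mulr0 ?subr0 ?expr1n ?subrr // => a _.
by move: noE; rewrite negb_exists => /forallP /(_ a) /negbTE ->.
Qed.

End ProductLaw.

(** * Occupied windows, their pair correlations, and blocked points *)

Section Occupancy.
Context {R : realFieldType} {C V : finType} {n m : nat} (q : C -> R).
Hypotheses (q_ge0 : forall c, 0 <= q c) (q_sum1 : \sum_c q c = 1).
Variables (win : V -> {set C}) (sub : V -> 'I_m -> C) (u w : R).
Hypothesis win_disjoint : forall v v' c, c \in win v -> c \in win v' -> v = v'.
Hypothesis sub_win : forall v a, sub v a \in win v.
Hypothesis sub_inj : forall v, injective (sub v).
Hypothesis q_sub : forall v a, q (sub v a) = u.
Hypothesis q_win : forall v, mass q (mem (win v)) = w.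
Hypothesis w_lt1 : w < 1.
Implicit Types (g : {ffun 'I_m -> 'I_n}) (f : {ffun 'I_n -> C}).

(** Excluding all other points from the window makes [g] a function of [v] and [f]: two injections
    never occupy the same window at once. *)
Definition occ v g f : bool :=
  [forall a, f (g a) == sub v a] &&
  [forall i, (i \notin codom g) ==> (f i \notin win v)].

Let side v g (i : 'I_n) (c : C) : bool :=
  if [pick a | g a == i] is Some a then c == sub v a else c \notin win v.

Let side_in v g a c : injective g -> side v g (g a) c = (c == sub v a).
Proof.
move=> g_inj; rewrite /side; case: pickP => [b /eqP/g_inj ->//|/(_ a)].
by rewrite eqxx.
Qed.

Let side_out v g i c : i \notin codom g -> side v g i c = (c \notin win v).
Proof.
move=> ig; rewrite /side; case: pickP => [b /eqP gb|//].
by rewrite -gb codom_f in ig.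
Qed.

Let occE v g : injective g -> occ v g =1 fun f => [forall i, side v g i (f i)].
Proof.
move=> g_inj f; apply/andP/forallP => [[/forallP fg /forallP fo] i|h].
  have [/codomP[a ->]|ig] := boolP (i \in codom g); first by rewrite side_in.
  by rewrite side_out //; have := fo i; rewrite ig.
split; apply/forallP => i; first by rewrite -(side_in v _ _ g_inj).
by apply/implyP => ig; rewrite -(side_out _ _ ig).
Qed.

Let u_ge0 (v : V) (a : 'I_m) : 0 <= u.
Proof. by rewrite -(q_sub v a). Qed.

Let mass_side v g i : injective g ->
  mass q (side v g i) = if i \in codom g then u else 1 - w.
Proof.
move=> g_inj; case: ifPn => [/codomP[a ->]|ig].
  rewrite -(q_sub v a) -mass1; apply: eq_bigl => c; by rewrite side_in.
rewrite -(q_win v) -massC //; apply: eq_bigl => c; by rewrite side_out.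
Qed.

Lemma card_codom_inj g : injective g -> #|codom g| = m.
Proof. by move=> g_inj; rewrite card_codom // card_ord. Qed.

Lemma pr_occ v g : injective g -> pr q (occ v g) = u ^+ m * (1 - w) ^+ (n - m).
Proof.
move=> g_inj; rewrite (eq_pr _ (occE v g_inj)) pr_box.
under eq_bigr do rewrite mass_side //.
rewrite (bigID (mem (codom g))) /=.
rewrite (eq_bigr (fun=> u)); last by move=> i ->.
rewrite [X in _ * X](eq_bigr (fun=> 1 - w)); last by move=> i /negbTE ->.
rewrite !prodr_const card_codom_inj //; congr (_ * _ ^+ _).
rewrite -[X in (X - m)%N]card_ord -(cardC (mem (codom g))) card_codom_inj //.
by rewrite addKn.
Qed.

Lemma occ_uniq v g g' f : injective g -> injective g' ->
  occ v g f -> occ v g' f -> g = g'.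
Proof.
move=> g_inj g'_inj /andP[/forallP fg /forallP fo] /andP[/forallP fg' _].
apply/ffunP => a; have [/codomP[b gb]|g'a] := boolP (g' a \in codom g).
  have := fg b; rewrite -gb (eqP (fg' a)) => /eqP/sub_inj ab.
  by rewrite gb ab.
by have := fo (g' a); rewrite g'a (eqP (fg' a)) sub_win.
Qed.

(** Near independence of two windows, one point at a time. A point used by both has no admissible
    cell, since the windows are disjoint. For a point used by one, only that condition is kept, at
    the cost of a factor [(1 - w)^-1]. A point used by neither gives [1 - 2 w <= (1 - w)^2]. *)
Let mass_side2 v v' g g' i : v != v' -> injective g -> injective g' ->
  mass q (fun c => side v g i c && side v' g' i c) <=
  (if (i \in codom g) || (i \in codom g') then (1 - w)^-1 else 1) *
  (mass q (side v g i) * mass q (side v' g' i)).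
Proof.
move=> vv' g_inj g'_inj; have w1 : 0 < 1 - w by rewrite subr_gt0.
rewrite !mass_side //.
have [ig|ig] := boolP (i \in codom g); have [ig'|ig'] := boolP (i \in codom g').
- have /codomP[a ia] := ig; have /codomP[a' ia'] := ig'.
  rewrite [X in X <= _]big_pred0 /=; last first.
    move=> c; apply/negP; rewrite {1}ia ia' !side_in // => /andP[/eqP-> /eqP e].
    by move/eqP: vv'; apply; apply: (win_disjoint (sub_win v a)); rewrite e.
  have u0 := u_ge0 v a; rewrite mulr_ge0 ?invr_ge0 ?(ltW w1) //.
  exact: mulr_ge0.
- have /codomP[a ia] := ig.
  rewrite /= [leRHS](_ : _ = u); last by field; rewrite gt_eqF.
  rewrite -(q_sub v a) -mass1; apply: mass_le => // c.
  by rewrite {1}ia side_in // => /andP[].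
- have /codomP[a ia] := ig'.
  rewrite /= [leRHS](_ : _ = u); last by field; rewrite gt_eqF.
  rewrite -(q_sub v' a) -mass1; apply: mass_le => // c.
  by rewrite {2}ia side_in // => /andP[].
- rewrite /= mul1r.
  have -> : mass q (fun c => side v g i c && side v' g' i c) = 1 - 2 * w.
    transitivity (mass q (predC [predU win v & win v'])).
      by apply: eq_bigl => c; rewrite !side_out //= -negb_or.
    rewrite massC // /mass (bigID (mem (win v))) /=.
    rewrite [X in _ - (X + _)](_ : _ = w); last first.
      rewrite -(q_win v) /mass; apply: eq_bigl => c; rewrite !inE.
      by case: (c \in win v); rewrite ?andbF.
    rewrite [X in _ - (_ + X)](_ : _ = w); first by ring.
    rewrite -(q_win v') /mass; apply: eq_bigl => c; rewrite !inE.
    have [cv|] := boolP (c \in win v); last by rewrite andbT.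
    rewrite andbF; symmetry; apply/negP => cv'.
    by move/eqP: vv'; apply; apply: win_disjoint cv cv'.
  by rewrite -subr_ge0; have := sqr_ge0 w; rewrite expr2; lra.
Qed.

(** At most [m + m] points are used by the two events, each contributing one factor [(1 - w)^-1];
    within one window, different injections exclude each other. *)
Lemma pr_occ2 v v' g g' : (v, g) != (v', g') -> injective g -> injective g' ->
  pr q (fun f => occ v g f && occ v' g' f) <=
  (1 - w) ^- (m + m) * (u ^+ m * (1 - w) ^+ (n - m)) ^+ 2.
Proof.
move=> vg g_inj g'_inj; have w1 : 0 < 1 - w by rewrite subr_gt0.
have w_ge0 : 0 <= w by rewrite -(q_win v) mass_ge0.
have [vv'|vv'] := eqVneq v v'.
  rewrite [leLHS](_ : _ = 0).
    apply: mulr_ge0; first by rewrite invr_ge0 exprn_ge0 // ltW.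
    exact: sqr_ge0.
  apply: big_pred0 => f; apply/negP; rewrite -vv' => /andP[occ1 occ2].
  by move/eqP: vg; apply; rewrite vv' (occ_uniq g_inj g'_inj occ1 occ2).
rewrite (@eq_pr _ _ _ _ _
    (fun f => [forall i, side v g i (f i) && side v' g' i (f i)])); last first.
  move=> f; rewrite !occE //; apply/andP/forallP => [[/forallP h /forallP h'] i|h].
    by rewrite h h'.
  by split; apply/forallP => i; have /andP[] := h i.
rewrite (pr_box _ (fun i c => side v g i c && side v' g' i c)).
apply: (@le_trans _ _ (\prod_i
    ((if (i \in codom g) || (i \in codom g') then (1 - w)^-1 else 1) *
     (mass q (side v g i) * mass q (side v' g' i))))).
  by apply: ler_prod => i _; rewrite mass_ge0 //= mass_side2.
rewrite !big_split /= expr2.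
have P v1 g1 : injective g1 ->
    \prod_i mass q (side v1 g1 i) = u ^+ m * (1 - w) ^+ (n - m).
  by move=> g1_inj; rewrite -(pr_occ v1 g1_inj) (eq_pr _ (occE v1 g1_inj)) pr_box.
rewrite !P //; apply: ler_wpM2r.
  by rewrite -(pr_occ v g_inj) -expr2 sqr_ge0.
rewrite -big_mkcond /= prodr_const -exprVn; apply: ler_weXn2l.
  by rewrite invf_ge1 // gerBl.
apply: leq_trans (_ : (#|codom g| + #|codom g'| <= _)%N).
  by rewrite -cardUI; apply: leq_trans (leq_addr _ _); apply: subset_leq_card;
    apply/fintype.subsetP => i; rewrite !inE.
by rewrite !card_codom_inj.
Qed.

(** [lam] is the expected number of occupied pairs. The subevents [E] enter the first moment with
    the fraction [th] that they retain; the second moment is bounded through [occ] itself, with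
    [lam] from the diagonal and at most [(1 - w)^-(m + m) lam^2] from the other pairs. *)
Lemma pr_occ_exists (th c : R)
    (E : V -> {ffun 'I_m -> 'I_n} -> pred {ffun 'I_n -> C})
    (lam := (#|V| * n ^_ m)%:R * (u ^+ m * (1 - w) ^+ (n - m))) :
  0 <= c ->
  (forall v g f, E v g f -> occ v g f) ->
  (forall v g, injective g -> th * pr q (occ v g) <= pr q (E v g)) ->
  2 * c * (th * lam) - c ^+ 2 * (lam + (1 - w) ^- (m + m) * lam ^+ 2) <=
  pr q (fun f => [exists v, exists g : {ffun 'I_m -> 'I_n}, injectiveb g && E v g f]).
Proof.
move=> c0 Eocc prE; pose p := u ^+ m * (1 - w) ^+ (n - m).
pose rho := (1 - w) ^- (m + m).
have w1 : 0 < 1 - w by rewrite subr_gt0.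
pose G (a : V * {ffun 'I_m -> 'I_n}) f := injectiveb a.2 && E a.1 a.2 f.
rewrite [leRHS](@eq_pr _ _ _ _ _ (fun f => [exists a, G a f])); last first.
  move=> f; apply/existsP/existsP => [[v /existsP[g h]]|[[v g] h]].
    by exists (v, g).
  by exists v; apply/existsP; exists g.
apply: le_trans (pr_exists_ge q_ge0 G c).
have prG a : pr q (G a) <= (injectiveb a.2)%:R * p.
  have [/injectiveP g_inj|g_inj] := boolP (injectiveb a.2).
    rewrite mul1r /p -(pr_occ a.1 g_inj); apply: pr_le => // f /andP[_].
    exact: Eocc.
  rewrite mul0r /pr big_pred0 // => f; by rewrite /G (negbTE g_inj).
have card_g : \sum_(g : {ffun 'I_m -> 'I_n}) (injectiveb g : nat) = n ^_ m.
  have := card_inj_ffuns 'I_m 'I_n; rewrite !card_ord => <-; rewrite -sum1_card.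
  by rewrite [RHS]big_mkcond; apply: eq_bigr => g _; rewrite inE; case: injectiveb.
have sumI : \sum_(a : V * {ffun 'I_m -> 'I_n}) (injectiveb a.2)%:R * p = lam.
  rewrite -mulr_suml; congr (_ * p); rewrite -natr_sum; congr _%:R.
  rewrite -(pair_bigA _ (fun _ g => injectiveb g : nat)) /=.
  by rewrite sum_nat_const card_g.
have p_ge0 (v : V) g : injective g -> 0 <= p.
  by move=> g_inj; rewrite /p -(pr_occ v g_inj) pr_ge0.
have rho_ge0 : 0 <= rho by rewrite invr_ge0 exprn_ge0 // ltW.
apply: lerB.
  apply: ler_wpM2l; first by rewrite mulr_ge0.
  rewrite -sumI mulr_sumr; apply: ler_sum => a _.
  have [/injectiveP g_inj|g_inj] := boolP (injectiveb a.2).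
    rewrite mul1r /p -(pr_occ a.1 g_inj); apply: le_trans (prE _ _ g_inj) _.
    by apply: pr_le => // f; rewrite /G => ->; rewrite andbT; exact/injectiveP.
  by rewrite mul0r mulr0 pr_ge0.
apply: ler_wpM2l; first exact: sqr_ge0.
rewrite -sumI expr2 mulr_suml mulr_sumr -big_split /=; apply: ler_sum => a _.
rewrite (bigD1 a) //=; apply: lerD.
  rewrite (@eq_pr _ _ _ _ _ (G a)) => [|f]; [exact: prG|exact: andbb].
rewrite mulr_sumr [leRHS]mulr_sumr [leRHS](bigID (pred1 a)) /=.
rewrite -[leLHS]add0r; apply: lerD.
  rewrite big_pred1_eq; case: injectiveP => [g_inj|_]; last by rewrite !mul0r mulr0.
  by rewrite !mul1r mulr_ge0 // -expr2 sqr_ge0.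
apply: ler_sum => b ba.
have [/injectiveP ga|ga] := boolP (injectiveb a.2); last first.
  rewrite !mul0r mulr0 /pr big_pred0 // => f.
  by rewrite /G (negbTE ga).
have [/injectiveP gb|gb] := boolP (injectiveb b.2); last first.
  rewrite !mul0r !mulr0 /pr big_pred0 // => f.
  by rewrite /G (negbTE gb) andbF.
rewrite !mul1r -expr2.
apply: le_trans (@pr_occ2 a.1 b.1 a.2 b.2 _ ga gb).
  apply: pr_le => // f /andP[/andP[_ /Eocc ->]] /andP[_ /Eocc ->]//.
by rewrite -!surjective_pairing eq_sym.
Qed.

Variables (blk : V -> C -> C -> bool) (tau : R).
(** The weight [q z] on both sides restricts the bound to cells of positive mass: the cell outside
    the grid has mass 0, and its tube is everything. *)
Hypothesis mass_blk : forall v z, q z * mass q (blk v z) <= q z * tau.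

(** With tubes as [blk], and under [occ], this contains every point outside the cluster whose
    simplex with the cluster meets the rest of the sample. *)
Definition blocked v g f : {set 'I_n} :=
  [set j | (j \notin codom g) &&
    [exists i, [&& i \notin codom g, i != j & blk v (f j) (f i)]]].

(** Union bound over the cell [z] of point [j]. For fixed [z] the event lies in a box: [j] in [z],
    [i] in [blk v z], the cluster in its cells, all other points free. *)
Let pr_blocked v g i j : injective g -> i \notin codom g -> j \notin codom g ->
  i != j -> pr q (fun f => occ v g f && blk v (f j) (f i)) <= u ^+ m * tau.
Proof.
move=> g_inj ig jg ij.
pose S z k c := if k == j then c == z else if k == i then blk v z c else
  if [pick a | g a == k] is Some a then c == sub v a else true.
apply: (@le_trans _ _ (\sum_z pr q (fun f => [forall k, S z k (f k)]))).
  apply: le_trans (pr_exists q_ge0 _); apply: pr_le => // f.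
  move=> /andP[/andP[/forallP fg _] b]; apply/existsP; exists (f j).
  apply/forallP => k; rewrite /S; case: eqVneq => [->//|_].
  by case: eqVneq => [->//|_]; case: pickP => [a /eqP <-|].
under eq_bigr do rewrite pr_box.
have prS z : \prod_k mass q (S z k) = u ^+ m * (q z * mass q (blk v z)).
  rewrite (bigD1 j) //= (bigD1 i) //= mulrA.
  rewrite [X in X * _ * _](_ : _ = q z); last first.
    by rewrite -mass1; apply: eq_bigl => c; rewrite /S eqxx.
  rewrite [X in _ * X * _](_ : _ = mass q (blk v z)); last first.
    by apply: eq_bigl => c; rewrite /S eqxx (negbTE ij).
  rewrite mulrC; congr (_ * _).
  rewrite (bigID (mem (codom g))) /= [X in _ * X]big1 ?mulr1; last first.
    move=> k /andP[/andP[kj ki] kg]; rewrite -q_sum1; apply: eq_bigl => c.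
    rewrite /S (negbTE kj) (negbTE ki); case: pickP => [a /eqP ga|//].
    by rewrite -ga codom_f in kg.
  rewrite (eq_bigr (fun=> u)).
    rewrite prodr_const; congr (_ ^+ _); rewrite -[RHS](card_codom_inj g_inj).
    apply: eq_card => k; rewrite -[LHS]/((k != j) && (k != i) && (k \in codom g)).
    apply/andb_idl => kg.
    by apply/andP; split; [apply: contraNneq jg|apply: contraNneq ig] => <-.
  move=> k /andP[/andP[kj ki] /codomP[a ka]].
  rewrite -(q_sub v a) -mass1; apply: eq_bigl => c.
  rewrite /S (negbTE kj) (negbTE ki) ka; case: pickP => [b /eqP/g_inj -> //|].
  by move=> /(_ a); rewrite eqxx.
under eq_bigr do rewrite prS.
rewrite -mulr_sumr; apply: ler_wpM2l.
  (* [u] is nonnegative as the mass of a prescribed cell; for [m = 0] there is none, and the power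
     is 1. *)
  by case: (m) sub q_sub => [//|m'] s qs; rewrite exprn_ge0 // -(qs v ord0).
rewrite -[leRHS]mul1r -q_sum1 mulr_suml; exact: ler_sum.
Qed.

(** Markov inequality: on the bad event more than [n / 2] points are blocked, so [n] times its
    probability is at most twice the expected number of pairs in which [i] blocks [j] under [occ], a
    sum over at most [n^2] pairs. *)
Lemma pr_occ_unblocked v g : injective g ->
  pr q (occ v g) - 2 * n%:R * (u ^+ m * tau) <=
  pr q (fun f => occ v g f && (#|blocked v g f| * 2 <= n)%N).
Proof.
move=> g_inj; rewrite lerBlDr.
pose bad f := occ v g f && (n < #|blocked v g f| * 2)%N.
have -> : pr q (occ v g) =
    pr q (fun f => occ v g f && (#|blocked v g f| * 2 <= n)%N) + pr q bad.
  rewrite /pr (bigID (fun f : {ffun 'I_n -> C} => #|blocked v g f| * 2 <= n)%N) /=.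
  by congr (_ + _); apply: eq_bigl => f; rewrite /bad ltnNge.
rewrite lerD2l.
have [n0|n_gt0] := posnP n.
  rewrite /pr big_pred0; last first.
    move=> f; apply/negbTE; rewrite negb_and -leqNgt orbC.
    by rewrite (leq_trans (leq_mul (max_card _) (leqnn 2))) // card_ord n0.
  by rewrite n0 mulr0 mul0r.
have nR : (0 : R) < n%:R by rewrite ltr0n.
rewrite -(ler_pM2l nR).
have -> : n%:R * (2 * n%:R * (u ^+ m * tau)) = 2 * (n%:R ^+ 2 * (u ^+ m * tau)) :> R.
  by ring.
(* The masses add up to 1, so some cell has positive mass, and [mass_blk] at that cell gives the
   sign. *)
have tau_ge0 : 0 <= tau.
  have [c qc] : exists c, 0 < q c.
    apply/existsP; apply: contraT; rewrite negb_exists => /forallP h.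
    suff : (1 : R) = 0 by move/eqP; rewrite oner_eq0.
    rewrite -q_sum1 big1 // => c _; apply/eqP; rewrite eq_le q_ge0 andbT.
    by rewrite leNgt.
  by rewrite -(ler_pM2l qc) (le_trans _ (mass_blk v c)) // mulr0 mulr_ge0 ?mass_ge0.
have um_ge0 : 0 <= u ^+ m.
  by case: (m) sub q_sub => [//|m'] s qs; rewrite exprn_ge0 // -(qs v ord0).
pose bl i j f := [&& j \notin codom g, i \notin codom g, i != j &
  occ v g f && blk v (f j) (f i)].
apply: (@le_trans _ _ (2 * \sum_(i : 'I_n) \sum_(j : 'I_n) pr q (bl i j))); last first.
  apply: ler_wpM2l => //.
  have nE (x : R) : n%:R * x = \sum_(i < n) x.
    by rewrite sumr_const card_ord mulr_natl.
  rewrite expr2 -mulrA nE; apply: ler_sum => i _.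
  rewrite nE; apply: ler_sum => j _.
  have [jg|jg] := boolP (j \in codom g).
    by rewrite /pr big_pred0 ?mulr_ge0 // => f; rewrite /bl jg.
  have [ig|ig] := boolP (i \in codom g).
    by rewrite /pr big_pred0 ?mulr_ge0 // => f; rewrite /bl ig andbF.
  have [ij|ij] := eqVneq i j.
    by rewrite /pr big_pred0 ?mulr_ge0 // => f; rewrite /bl ij eqxx !andbF.
  apply: le_trans (pr_blocked v g_inj ig jg ij).
  by apply: pr_le => // f /and4P[].
rewrite exchange_big pr_sum !mulr_sumr.
under [leRHS]eq_bigr do under eq_bigr do rewrite pr_sum.
under [leRHS]eq_bigr do rewrite exchange_big mulr_sumr.
rewrite exchange_big /=; apply: ler_sum => f _.
under eq_bigr do rewrite -mulr_sumr mulrCA.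
rewrite -mulr_sumr mulrCA; apply: ler_wpM2l; first exact: weight_ge0.
have [/andP[occf lt]|_] := boolP (bad f); last first.
  rewrite mulr0; apply: sumr_ge0 => j _; rewrite mulr_ge0 //; exact: sumr_ge0.
rewrite mulr1 -mulr_sumr; apply: (@le_trans _ _ (2 * #|blocked v g f|%:R)).
  by rewrite -natrM ler_nat mulnC ltnW.
apply: ler_wpM2l => //.
rewrite -sum1_card natr_sum big_mkcond; apply: ler_sum => j _.
case: ifPn => [|_]; last exact: sumr_ge0.
rewrite inE => /andP[jg /existsP[i /and3P[ig ij bij]]].
rewrite (bigD1 i) //= /bl jg ig ij occf bij /= lerDl; exact: sumr_ge0.
Qed.

End Occupancy.

(** * Degree and convex hulls *)

Section Degree.
Context {R : realType} {M : nat}.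
Implicit Types (A B : set 'rV[R]_M) (S : {fset 'rV[R]_M}).

Lemma conv_hull_sub A B : convex_set B -> A `<=` B -> conv_hull A `<=` B.
Proof. by move=> cB AB; apply: smallest_sub. Qed.

Lemma sub_conv_hull A : A `<=` conv_hull A.
Proof. exact: sub_smallest. Qed.

Variables (n : nat) (X : 'I_n -> 'rV[R]_M).
Let XX := [fset X i | i in 'I_n]%fset.

(** A certificate for degree at least [#|J'|] in terms of indices: these form a fixed finite set, so
    measurability can be settled one pair of sets at a time. The points need not be distinct, hence
    emptiness asks for equality with a vertex as a point. *)
Definition star (J J' : {set 'I_n}) : Prop :=
  [/\ #|J| = M, [disjoint J & J']%bool,
      {in J :|: J' &, injective X} &
      forall z, z \in J' -> forall i,
        conv_hull (X @` [set` z |: J]) (X i) ->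
        exists2 a, a \in z |: J & X i = X a].

Let image_set1U z (J : {set 'I_n}) :
  X @` [set` z |: J] = [set` (X z |` [fset X i | i in J])%fset].
Proof.
apply/seteqP; split => [_ [i /= iJ <-]|x /=].
  move: iJ; rewrite in_setU1 in_fset1U => /orP[/eqP->|iJ]; first by rewrite eqxx.
  by apply/orP; right; apply/imfsetP; exists i.
rewrite in_fset1U => /orP[/eqP->|/imfsetP[i /= iJ ->]].
  by exists z; rewrite //= !inE eqxx.
by exists i; rewrite //= !inE iJ orbT.
Qed.

Let in_XX i : X i \in XX.
Proof. by apply/imfsetP; exists i. Qed.

Let card_image (J : {set 'I_n}) : {in J &, injective X} ->
  #|` [fset X i | i in J]|%fset = #|J|.
Proof.
move=> Xinj; rewrite card_in_imfset // cardE.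
apply/perm_size/uniq_perm; [exact: enum_finmem_uniq|exact: enum_uniq|].
by move=> i; rewrite [RHS]mem_enum enum_finmemE.
Qed.

Lemma star_degree J J' : star J J' -> (#|J'| <= degree XX)%N.
Proof.
move=> [JM JJ' Xinj hull].
have sJ : {subset J <= J :|: J'} by move=> i; rewrite inE => ->.
have sJ' : {subset J' <= J :|: J'} by move=> i; rewrite inE orbC => ->.
pose S := [fset X i | i in J]%fset.
have SX : (S `<=` XX)%fset by apply/fsubsetP => _ /imfsetP[i /= _ ->].
have SM : #|` S|%fset == M.
  by rewrite card_image ?JM // => i j /= /sJ iJ /sJ jJ; exact: Xinj.
apply: leq_trans (leq_bigmax_seq (P := fun S => #|` S|%fset == M) S _ SM); last first.
  by rewrite fpowersetE.
have <- : #|` [fset X i | i in J']%fset |%fset = #|J'|.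
  by rewrite card_image // => i j /= /sJ' iJ /sJ' jJ; exact: Xinj.
apply/fsubset_leq_card/fsubsetP => _ /imfsetP[z /= zJ' ->].
rewrite !inE /= in_XX andbT; apply/andP; split.
  apply/imfsetP => -[i /= iJ Xzi].
  have zi : z = i by apply: Xinj => //; [exact: sJ'|exact: sJ].
  by move/pred0P: JJ' => /(_ i) /=; rewrite iJ -zi zJ'.
apply/asboolP; apply/seteqP; split => [x [hx /imfsetP[i /= _ xi]]|x xS].
  move: hx; rewrite xi -image_set1U => /(hull _ zJ')[a aJ ->].
  suff : ([set` (X z |` S)%fset] : set _) (X a) by [].
  by rewrite -image_set1U; exists a.
split; first exact: sub_conv_hull.
move: xS => /=; rewrite in_fset1U => /orP[/eqP->|/(fsubsetP SX)//].
exact: in_XX.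
Qed.

(** Converse of [star_degree]; together they make [s <= degree] a finite union of [star] events. A
    positive [s] ensures that some [M]-subset realizes the degree. *)
Lemma degree_star (s : nat) : (0 < s)%N -> (s <= degree XX)%N ->
  exists J J' : {set 'I_n}, star J J' /\ (s <= #|J'|)%N.
Proof.
case: s => [//|s] _ sd.
have [S [SX SM sS]] : exists S, [/\ (S `<=` XX)%fset, #|` S|%fset = M &
    (s < degree_of XX S)%N].
  apply: contrapT => noS; move: sd; rewrite ltnNge; apply/negP/negPn.
  apply/bigmax_leqP_seq => S; rewrite fpowersetE => SX /eqP SM.
  by rewrite leqNgt; apply/negP => sS; apply: noS; exists S.
set Z := [fset z in (XX `\` S)%fset | `[< empty_in XX (z |` S)%fset >]]%fset in sS.
(* One representative index for each point, so that sets of points turn into sets of indices of the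
   same size. *)
pose rep i := [pick k | X k == X i] == Some i.
have rep_inj i j : rep i -> rep j -> X i = X j -> i = j.
  by move=> /eqP ri /eqP rj ij; apply: Some_inj; rewrite -ri -rj ij.
have repP x : x \in XX -> exists2 i, rep i & X i = x.
  move=> /imfsetP[i _ ->]; case E : [pick k | X k == X i] => [j|]; last first.
    by move: E; case: pickP => // /(_ i); rewrite eqxx.
  exists j; last by move: E; case: pickP => // k /eqP Xk [<-].
  rewrite /rep; have -> : X j = X i.
    by move: E; case: pickP => // k /eqP Xk [<-].
  by rewrite E.
pose idx (A : {fset 'rV[R]_M}) := [set i | rep i & X i \in A].
have idxE (A : {fset 'rV[R]_M}) : (A `<=` XX)%fset -> A = [fset X i | i in idx A]%fset.
  move=> /fsubsetP AX; apply/fsetP => x; apply/idP/imfsetP => [xA|[i /=]].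
    have [i ri ix] := repP _ (AX _ xA).
    by exists i; rewrite //= inE ri ix.
  by rewrite inE => /andP[_ iA] ->.
have card_idx (A : {fset 'rV[R]_M}) : (A `<=` XX)%fset -> #|` A|%fset = #|idx A|.
  move=> AX; rewrite {1}(idxE A AX) card_image // => i j /=.
  by rewrite !inE => /andP[ri _] /andP[rj _]; exact: rep_inj.
have ZX : (Z `<=` XX)%fset.
  by apply/fsubsetP => x; rewrite !inE /= => /andP[/andP[_ ->]].
exists (idx S), (idx Z); rewrite -card_idx //; split => //; split.
- by rewrite -card_idx.
- apply/pred0P => i /=; rewrite !inE /=; apply/negP.
  by move=> /andP[/andP[_ iS] /andP[_]]; rewrite iS.
- move=> i j; rewrite !inE => /orP ri /orP rj; apply: rep_inj.
    by case: ri => /andP[].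
  by case: rj => /andP[].
- move=> z; rewrite inE => /andP[rz zZ] i.
  rewrite image_set1U -idxE // => hi.
  move: zZ; rewrite !inE /= => /andP[_ /asboolP zS].
  have : ([set` (X z |` S)%fset] : set _) (X i) by rewrite -zS; split => //=.
  rewrite /= in_fset1U => /orP[/eqP->|iS]; first by exists z; rewrite // !inE eqxx.
  have : X i \in [fset X i | i in idx S]%fset by rewrite -idxE.
  by move=> /imfsetP[a /= aS ia]; exists a; rewrite // inE aS orbT.
Qed.

End Degree.

(** * Convex hulls inside cones and as convex combinations *)

Section ConvexHull.
Context {R : realType} {M : nat}.
Implicit Types (A C : set 'rV[R]_M).

Lemma convex_setP C : convex_set C <->
  forall (x y : 'rV[R]_M) (l : R), 0 <= l <= 1 -> C x -> C y ->
    C (l *: x + (1 - l) *: y).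
Proof.
split => [cC x y l /andP[l0 l1] Cx Cy|cC x y l].
  by have := cC x y (Itv01 l0 l1); rewrite !inE; apply.
by rewrite !inE => Cx Cy; apply: cC => //; rewrite ge0 le1.
Qed.

(** The conclusion describes the cone with apex [z] over the box, with [s] the time along the
    segments towards [z]. The cone is convex and contains [A]. *)
Lemma conv_hull_cone A (lo hi : 'I_M -> R) (z y : 'rV[R]_M) :
  (forall x, A x -> x = z \/ forall i, lo i <= x ord0 i <= hi i) ->
  conv_hull A y ->
  exists2 s : R, 0 <= s <= 1 & forall i,
    (1 - s) * lo i + s * z ord0 i <= y ord0 i <= (1 - s) * hi i + s * z ord0 i.
Proof.
have [i0|noi] := pselect (exists i : 'I_M, True); last first.
  by move=> _ _; exists 0 => [|i]; [rewrite lexx ler01|case: noi; exists i].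
move=> Abox.
pose C := [set y : 'rV[R]_M | exists2 s : R, 0 <= s <= 1 & forall i,
  (1 - s) * lo i + s * z ord0 i <= y ord0 i <= (1 - s) * hi i + s * z ord0 i].
apply: (@conv_hull_sub _ _ A C) => [|x /Abox[->|xb]]; last 2 first.
- by exists 1 => [|i]; rewrite ?ler01 ?lexx // subrr !mul0r !add0r mul1r lexx.
- by exists 0 => [|i]; rewrite ?ler01 ?lexx // subr0 !mul0r !addr0 !mul1r.
apply/convex_setP => x x' l /andP[l0 l1] [s /andP[s0 s1] xs] [s' /andP[s'0 s'1] xs'].
have l'0 : 0 <= 1 - l by rewrite subr_ge0.
(* The bounds are affine in [s], so a convex combination of two points has the same combination of
   their times. *)
exists (l * s + (1 - l) * s').
  apply/andP; split; first by rewrite addr_ge0 // mulr_ge0.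
  apply: (@le_trans _ _ (l * 1 + (1 - l) * 1)); last by rewrite !mulr1; lra.
  by apply: lerD; apply: ler_wpM2l.
move=> i; have /andP[a b] := xs i; have /andP[a' b'] := xs' i; rewrite !mxE.
have comb (e : 'I_M -> R) :
    (1 - (l * s + (1 - l) * s')) * e i + (l * s + (1 - l) * s') * z ord0 i =
    l * ((1 - s) * e i + s * z ord0 i) +
    (1 - l) * ((1 - s') * e i + s' * z ord0 i) by ring.
by rewrite !comb; apply/andP; split; rewrite lerD // ler_wpM2l.
Qed.

Lemma convex_set_sum (I : eqType) (r : seq I) (C : set 'rV[R]_M)
    (a : I -> R) (x : I -> 'rV[R]_M) :
  convex_set C -> (forall i, 0 <= a i) -> (forall i, a i != 0 -> C (x i)) ->
  \sum_(i <- r) a i = 1 -> C (\sum_(i <- r) a i *: x i).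
Proof.
move=> /convex_setP cC a0 Cx.
(* Partial sums of the weights do not add up to 1, so the induction runs on the normalized
   combinations. *)
suff S : 0 < \sum_(i <- r) a i ->
    C ((\sum_(i <- r) a i)^-1 *: \sum_(i <- r) a i *: x i).
  by move=> s1; move: S; rewrite s1 invr1 scale1r; apply.
elim: r => [|i r IH]; first by rewrite big_nil ltxx.
rewrite !big_cons; set s := \sum_(j <- r) a j in IH *.
have s_ge0 : 0 <= s by exact: sumr_ge0.
have [ai0|ai0] := eqVneq (a i) 0; first by rewrite ai0 scale0r !add0r.
have ai_gt0 : 0 < a i by rewrite lt_neqAle eq_sym ai0 a0.
have [s0|s0] := eqVneq s 0.
  have -> : \sum_(j <- r) a j *: x j = 0.
    have : all (fun j => a j == 0) r.
      by move: s0; rewrite /s => /eqP; rewrite psumr_eq0.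
    elim: (r) => [|j r' IH'] /=; first by rewrite big_nil.
    by move=> /andP[/eqP aj /IH' e]; rewrite big_cons e aj scale0r addr0.
  move=> _; rewrite s0 !addr0 scalerA mulVf // scale1r; exact: Cx.
have s_gt0 : 0 < s by rewrite lt_neqAle eq_sym s0.
move=> t_gt0; have t0 : a i + s != 0 by rewrite gt_eqF.
have := cC (x i) _ (a i / (a i + s)) _ (Cx _ ai0) (IH s_gt0).
rewrite (_ : _ *: _ + _ = (a i + s)^-1 *: (a i *: x i + \sum_(j <- r) a j *: x j)).
  by apply; rewrite divr_ge0 ?a0 ?(ltW t_gt0) //= ler_pdivrMr // mul1r lerDl.
rewrite scalerA scalerDr scalerA mulrC; congr (_ + _ *: _).
by field; apply/andP.
Qed.

Context {n : nat} (X : 'I_n -> 'rV[R]_M).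

(* One function, continuous in l and measurable in the points, that vanishes
   exactly when l are convex weights, supported on J, that represent x. *)
Definition hull_defect (J : {set 'I_n}) (x : 'rV[R]_M) (l : 'I_n -> R) : R :=
  \sum_(i | i \notin J) `|l i| + `|\sum_i l i - 1| +
  \sum_c `|x ord0 c - \sum_i l i * X i ord0 c|.

Lemma hull_defect_ge0 J x l : 0 <= hull_defect J x l.
Proof. by rewrite !addr_ge0 ?sumr_ge0. Qed.

(** The combinations with weights supported on [J] form a convex set that contains the points of
    [J]; conversely every convex set with these points contains the combinations. *)
Lemma conv_hullP (J : {set 'I_n}) (x : 'rV[R]_M) :
  conv_hull (X @` [set` J]) x <->
  exists2 l : 'I_n -> R, (forall i, 0 <= l i <= 1) & hull_defect J x l = 0.
Proof.
have defectP l : hull_defect J x l = 0 <->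
    [/\ forall i, i \notin J -> l i = 0, \sum_i l i = 1 &
        x = \sum_i l i *: X i].
  have coordE c : (\sum_i l i *: X i) ord0 c = \sum_i l i * X i ord0 c.
    by rewrite summxE; apply: eq_bigr => i _; rewrite mxE.
  split => [/eqP|[lJ l1 xl]].
    rewrite !paddr_eq0 ?addr_ge0 ?sumr_ge0 //.
    move=> /andP[/andP[/eqP e1 e2] /eqP e3]; split.
    - move=> i iJ; apply/eqP; rewrite -normr_eq0; apply/eqP.
      by apply: (psumr_eq0P _ e1).
    - by apply/eqP; rewrite -subr_eq0 -normr_eq0.
    - apply/rowP => c; rewrite coordE; apply/eqP; rewrite -subr_eq0 -normr_eq0.
      by apply/eqP; apply: (psumr_eq0P _ e3).
  rewrite /hull_defect l1 subrr normr0 addr0 [X in X + _]big1 ?add0r; last first.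
    by move=> i iJ; rewrite lJ ?normr0.
  by rewrite big1 // => c _; rewrite xl coordE subrr normr0.
split.
  pose C := [set x : 'rV[R]_M | exists l : 'I_n -> R,
    [/\ forall i, 0 <= l i, forall i, i \notin J -> l i = 0,
        \sum_i l i = 1 & x = \sum_i l i *: X i]].
  move=> hx; have : C x.
    move: hx; apply: conv_hull_sub => [|_ [i /= iJ <-]].
      apply/convex_setP => x1 x2 t /andP[t0 t1].
      move=> [l [l0 lJ l1 ->]] [l' [l'0 l'J l'1 ->]].
      exists (fun i => t * l i + (1 - t) * l' i); split.
      - by move=> i; rewrite addr_ge0 // mulr_ge0 // subr_ge0.
      - by move=> i iJ; rewrite lJ // l'J // !mulr0 addr0.
      - by rewrite big_split /= -!mulr_sumr l1 l'1 !mulr1 subrKC.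
      - rewrite !scaler_sumr -big_split /=; apply: eq_bigr => i _.
        by rewrite [RHS]scalerDl !scalerA.
    exists (fun j => (j == i)%:R); split => [j|j jJ||].
    - exact: ler0n.
    - by case: eqP jJ => // ->; rewrite iJ.
    - by rewrite (bigD1 i) //= eqxx big1 ?addr0 // => j /negbTE ->.
    - rewrite (bigD1 i) //= eqxx scale1r big1 ?addr0 // => j /negbTE ->.
      by rewrite scale0r.
  move=> [l [l0 lJ l1 xl]]; exists l; last exact/defectP.
  move=> i; rewrite l0 /= -l1 (bigD1 i) //= lerDl; exact: sumr_ge0.
move=> [l l01 /defectP[lJ l1 ->]].
apply: convex_set_sum => //.
- by apply/convex_setP => y z t t01 hy hz C [cC AC]; move/convex_setP: (cC);
    apply => //; [exact: hy|exact: hz].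
- by move=> i; have /andP[] := l01 i.
- move=> i li; apply: sub_conv_hull; exists i => //=.
  by apply: contraNT li => /lJ ->.
Qed.

End ConvexHull.

(** * Convex hulls through rational weights *)

Section HullCompactness.
Context {R : realType} {M n : nat} (X : 'I_n -> 'rV[R]_M).

Lemma hull_defect_continuous (J : {set 'I_n}) (x : 'rV[R]_M) :
  continuous (fun v : 'rV[R]_n => hull_defect X J x (v ord0)).
Proof.
have cont_sum (I : finType) (P : pred I) (F : I -> 'rV[R]_n -> R) :
    (forall i, P i -> continuous (F i)) ->
    continuous (fun v => \sum_(i | P i) F i v).
  by move=> cF; apply: continuous_big => //; exact: add_continuous.
have cont_norm (F : 'rV[R]_n -> R) :
    continuous F -> continuous (fun v => `|F v|).
  by move=> cF v; apply: continuous_comp; [exact: cF|exact: norm_continuous].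
have cont_coord (i : 'I_n) : continuous (fun v : 'rV[R]_n => v ord0 i).
  exact: coord_continuous.
have cont_add (F G : 'rV[R]_n -> R) :
    continuous F -> continuous G -> continuous (fun v => F v + G v).
  by move=> cF cG v; exact: (continuousD (cF v) (cG v)).
have cont_sub (F G : 'rV[R]_n -> R) :
    continuous F -> continuous G -> continuous (fun v => F v - G v).
  by move=> cF cG v; exact: (continuousB (cF v) (cG v)).
have cont_cst (a : R) : continuous (fun _ : 'rV[R]_n => a).
  exact: cst_continuous.
apply: (cont_add); first apply: (cont_add).
- apply: (cont_sum _ _ (fun i v => `|v ord0 i|)) => i _.
  exact: (cont_norm _ (cont_coord i)).
- apply: (cont_norm (fun v => _ - _)); apply: (cont_sub _ _ _ (cont_cst _)).
  exact: (cont_sum _ _ (fun i v => v ord0 i)).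
- apply: (cont_sum _ _ (fun c v => _)) => c _.
  apply: (cont_norm (fun v => _ - _)); apply: (cont_sub _ _ (cont_cst _)).
  apply: (cont_sum _ _ (fun i v => v ord0 i * _)) => i _ v.
  exact: (continuousM (cont_coord i v) (cont_cst _ v)).
Qed.

(** Membership in the hull becomes a countable intersection of countable unions, as measurability
    needs. Rational weights approximate exact ones by continuity; conversely, a positive minimum of
    the defect on the compact cube of weights would contradict the approximations. *)
Lemma conv_hull_rational (J : {set 'I_n}) (x : 'rV[R]_M) :
  conv_hull (X @` [set` J]) x <->
  forall m : nat, exists L : nat, exists a : {ffun 'I_n -> 'I_L.+2},
    hull_defect X J x (fun i => (a i)%:R / L.+1%:R) < m.+1%:R^-1.
Proof.
split => [/conv_hullP[l l01 dl] m|approx]; last first.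
  apply/conv_hullP.
  pose cube := [set v : 'rV[R]_n | forall i, `[0, 1]%classic (v ord0 i)].
  have cube_compact : compact cube.
    exact: (@rV_compact R n (fun=> `[0%R, 1%R]%classic) (fun _ => @segment_compact R 0 1)).
  have cube0 : cube !=set0.
    by exists 0 => i; rewrite mxE /= in_itv /= lexx ler01.
  have [v /set_mem vcube vmin] := compact_EVT_min cube0 cube_compact
    (continuous_subspaceT (@hull_defect_continuous J x)).
  exists (v ord0); first by move=> i; have := vcube i; rewrite /= in_itv.
  apply/eqP; rewrite eq_le hull_defect_ge0 andbT leNgt; apply/negP => d0.
  pose m := Num.truncn (hull_defect X J x (v ord0))^-1.
  have [L [a]] := approx m; apply/negP; rewrite -leNgt.
  apply: (@le_trans _ _ (hull_defect X J x (v ord0))).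
    rewrite invf_ple ?posrE ?ltr0n //.
    exact/ltW/truncnS_gt.
  pose u : 'rV[R]_n := \row_i ((a i)%:R / L.+1%:R).
  have -> : (fun i => (a i)%:R / L.+1%:R) = u ord0.
    by apply/funext => i; rewrite mxE.
  apply: vmin; apply/mem_set => i; rewrite mxE /= in_itv /= divr_ge0 //=.
  by rewrite ler_pdivrMr ?ltr0n // mul1r ler_nat -ltnS.
have : continuous_at (\row_i l i : 'rV[R]_n)
    (fun v : 'rV[R]_n => hull_defect X J x (v ord0)).
  exact: hull_defect_continuous.
move=> /cvgrPdist_lt /(_ m.+1%:R^-1); rewrite invr_gt0 ltr0n => /(_ isT).
have -> : (\row_i l i : 'rV[R]_n) ord0 = l by apply/funext => i; rewrite mxE.
rewrite dl => /nbhs_ballP[e /= e0 he].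
(* Weights are rounded down to multiples of [1 / L.+1], which is less than [e]. The numerators range
   from 0 to [L.+1], hence the type ['I_L.+2]. *)
pose L := Num.truncn e^-1; exists L.
have Le : L.+1%:R^-1 < e by rewrite invf_plt ?posrE ?ltr0n // truncnS_gt.
have L0 : (0 : R) < L.+1%:R by rewrite ltr0n.
have trunc_lt i : (Num.truncn (L.+1%:R * l i) < L.+2)%N.
  have /andP[l0 l1] := l01 i; rewrite ltnS -(ler_nat R).
  apply: (@le_trans _ _ (L.+1%:R * l i)); first by rewrite truncn_le mulr_ge0.
  by rewrite -[leRHS]mulr1 ler_wpM2l.
exists [ffun i => Ordinal (trunc_lt i)].
pose u : 'rV[R]_n := \row_i ((Num.truncn (L.+1%:R * l i))%:R / L.+1%:R).
have := he u; rewrite sub0r normrN ger0_norm ?hull_defect_ge0 //.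
rewrite (_ : u ord0 = (fun i => ([ffun i => Ordinal (trunc_lt i)] i)%:R / L.+1%:R)).
  apply; split => // i j; rewrite /ball /= !mxE.
  have /andP[l0 l1] := l01 j.
  have t0 : 0 <= L.+1%:R * l j by rewrite mulr_ge0.
  rewrite (_ : l j - _ = (L.+1%:R * l j - (Num.truncn (L.+1%:R * l j))%:R) /
    L.+1%:R); last by rewrite mulrBl [_ * l j]mulrC mulfK ?gt_eqF.
  rewrite normrM normfV (gtr0_norm L0).
  apply: le_lt_trans Le; rewrite ler_pdivrMr // mulVf ?gt_eqF //.
  rewrite ger0_norm ?subr_ge0 ?truncn_le // lerBlDr.
  by rewrite addrC natr1 ltW // truncnS_gt.
by apply/funext => i; rewrite mxE ffunE.
Qed.

End HullCompactness.

(** * Measurability of the degree *)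

Section MeasurableDegree.
Context {d : measure_display} {T : measurableType d} {R : realType} {M n : nat}.

Lemma measurable_forall_fin (I : finType) (F : I -> set T) :
  (forall i, measurable (F i)) -> measurable [set w | forall i, F i w].
Proof.
move=> mF; rewrite [X in measurable X](_ : _ = \bigcap_(i in setT) F i).
  by apply: fin_bigcap_measurable => // i _; exact: mF.
by apply/seteqP; split => w /= h; [move=> i _; exact: h|move=> i; exact: h].
Qed.

Lemma measurable_exists_fin (I : finType) (F : I -> set T) :
  (forall i, measurable (F i)) -> measurable [set w | exists i, F i w].
Proof.
move=> mF; rewrite [X in measurable X](_ : _ = \bigcup_(i in setT) F i).
  by apply: fin_bigcup_measurable => // i _; exact: mF.
by apply/seteqP; split => w /= [i]; [exists i|exists i].
Qed.

Lemma measurable_imply (Q : Prop) (F : set T) :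
  measurable F -> measurable [set w | Q -> F w].
Proof.
move=> mF; have [q|nq] := pselect Q.
  rewrite [X in measurable X](_ : _ = F) //.
  by apply/seteqP; split => w /=; [apply|].
rewrite [X in measurable X](_ : _ = setT) //.
by apply/seteqP; split => w /=.
Qed.

Lemma measurable_pred (b : T -> bool) :
  measurable_fun setT b -> measurable [set w | b w].
Proof.
move=> mb; rewrite (_ : [set w | b w] = setT `&` b @^-1` [set true]).
  exact: mb.
by rewrite setTI.
Qed.

Lemma measurable_borel_coord (c : 'I_M) :
  measurable_fun setT (fun v : borel_rV R M => (v : 'rV[R]_M) ord0 c).
Proof.
apply: (measurability _ (RGenOpens.measurableE R)).
move=> _ [_ [a [b ->]] <-]; rewrite setTI.
apply: sub_sigma_algebra; apply: open_comp; last exact: itv_open.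
by move=> v _; exact: coord_continuous.
Qed.

Variables (P : probability T R) (xi : 'I_n -> {RV P >-> borel_rV R M}).

Let X (w : T) (i : 'I_n) : 'rV[R]_M := xi i w.

Lemma measurable_coord (i : 'I_n) (c : 'I_M) :
  measurable_fun setT (fun w => X w i ord0 c).
Proof.
exact: measurableT_comp (measurable_borel_coord c) (measurable_funP (xi i)).
Qed.

Lemma measurable_hull (J : {set 'I_n}) (i : 'I_n) :
  measurable [set w | conv_hull (X w @` [set` J]) (X w i)].
Proof.
rewrite [X in measurable X](_ : _ = \bigcap_m \bigcup_L
    [set w | exists a : {ffun 'I_n -> 'I_L.+2},
      hull_defect (X w) J (X w i) (fun i => (a i)%:R / L.+1%:R) < m.+1%:R^-1]).
  apply: bigcapT_measurable => m; apply: bigcupT_measurable => L.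
  apply: measurable_exists_fin => a.
  apply: measurable_pred; apply: measurable_fun_ltr; last exact: measurable_cst.
  apply: measurable_funD; first exact: measurable_cst.
  apply: measurable_sum => c; apply: measurableT_comp => //.
  apply: measurable_funB; first exact: measurable_coord.
  apply: measurable_sum => j; apply: measurable_funM; first exact: measurable_cst.
  exact: measurable_coord.
apply/seteqP; split => w /=.
  by move=> /conv_hull_rational h m _; have [L h'] := h m; exists L.
move=> h; apply/conv_hull_rational => m; have [L _ h'] := h m Logic.I.
by exists L.
Qed.

Lemma measurable_eq_points (i j : 'I_n) : measurable [set w | X w i = X w j].
Proof.
rewrite [X in measurable X](_ : _ =
    [set w | forall c, X w i ord0 c = X w j ord0 c]).
  apply: measurable_forall_fin => c.
  rewrite [X in measurable X](_ : _ = [set w | X w i ord0 c == X w j ord0 c]).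
    by apply: measurable_pred; apply: measurable_fun_eqr; exact: measurable_coord.
  by apply/seteqP; split => w /= /eqP.
by apply/seteqP; split => w /= => [->//|h]; apply/rowP.
Qed.

Lemma measurable_star (J J' : {set 'I_n}) : measurable [set w | star (X w) J J'].
Proof.
have [cJ|cJ] := pselect (#|J| = M); last first.
  rewrite [X in measurable X](_ : _ = set0) //.
  by apply/seteqP; split => w // [].
have [dJ|dJ] := pselect [disjoint J & J']%bool; last first.
  rewrite [X in measurable X](_ : _ = set0) //.
  by apply/seteqP; split => w // [].
rewrite [X in measurable X](_ : _ =
  [set w | forall i j, [&& i \in J :|: J', j \in J :|: J' & i != j] ->
     (~` [set w | X w i = X w j]) w] `&`
  [set w | forall z i, z \in J' ->
    (~` [set w | conv_hull (X w @` [set` z |: J]) (X w i)] `|`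
     [set w | exists a, a \in z |: J /\ X w i = X w a]) w]).
  apply: measurableI.
    apply: measurable_forall_fin => i; apply: measurable_forall_fin => j.
    by apply: measurable_imply; apply: measurableC; exact: measurable_eq_points.
  apply: measurable_forall_fin => z; apply: measurable_forall_fin => i.
  apply: measurable_imply; apply: measurableU.
    by apply: measurableC; exact: measurable_hull.
  apply: measurable_exists_fin => a.
  have [az|az] := boolP (a \in z |: J).
    rewrite [X in measurable X](_ : _ = [set w | X w i = X w a]).
      exact: measurable_eq_points.
    by apply/seteqP; split => w /= => [[]|].
  rewrite [X in measurable X](_ : _ = set0) //.
  by apply/seteqP; split => w // [].
apply/seteqP; split => w /=.
  move=> [_ _ Xinj hull]; split.
    by move=> i j /and3P[iJ jJ /eqP ij] /(Xinj _ _ iJ jJ).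
  move=> z i zJ'; have [h|h] := pselect (conv_hull (X w @` [set` z |: J]) (X w i)).
    by right; have [a aJ ia] := hull _ zJ' _ h; exists a.
  by left.
move=> [Xinj hull]; split => //.
  move=> i j iJ jJ ij; apply: contrapT => /eqP nij.
  by apply: (Xinj i j) => //; rewrite iJ jJ.
move=> z zJ' i hi; have [//|[a [aJ ia]]] := hull z i zJ'.
by exists a.
Qed.

Lemma measurable_degree_ge (s : nat) :
  measurable [set w | (s <= degree (point_set xi w))%N].
Proof.
have [->|s0] := posnP s.
  by rewrite [X in measurable X](_ : _ = setT) //; apply/seteqP; split.
rewrite [X in measurable X](_ : _ =
  [set w | exists J J' : {set 'I_n}, (s <= #|J'|)%N /\ star (X w) J J']).
  apply: measurable_exists_fin => J; apply: measurable_exists_fin => J'.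
  have [sJ|sJ] := boolP (s <= #|J'|)%N.
    rewrite [X in measurable X](_ : _ = [set w | star (X w) J J']).
      exact: measurable_star.
    by apply/seteqP; split => w /= => [[]|].
  rewrite [X in measurable X](_ : _ = set0) //.
  by apply/seteqP; split => w // [].
apply/seteqP; split => w /=.
  by move=> /(degree_star s0)[J [J' [JJ' sJ']]]; exists J, J'.
by move=> [J [J' [sJ' /star_degree]]]; exact: leq_trans.
Qed.

End MeasurableDegree.

(** * Volumes of cubes and discretization of the sample *)

Section NonnegativeIntegral.
Local Open Scope ereal_scope.
Context {d : measure_display} {T : measurableType d} {R : realType}
  (mu : {measure set T -> \bar R}).
Implicit Types f g : T -> \bar R.

(** No measurability is assumed: the integral of a nonnegative function is a supremum over the
    simple functions below it. This allows comparing [lebesgue_rV] on arbitrary sets. *)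
Lemma integral_le_nonneg f g : (forall x, 0 <= f x) -> (forall x, f x <= g x) ->
  \int[mu]_x f x <= \int[mu]_x g x.
Proof.
move=> f0 fg; have g0 x : 0 <= g x by exact: le_trans (fg x).
rewrite !ge0_integralTE //; apply: le_ereal_sup => _ [h hf <-].
by exists h => // x; exact: le_trans (fg x).
Qed.

Lemma integral_ge_indic f (a : R) (A : set T) : measurable A -> (0 <= a)%R ->
  (forall x, 0 <= f x) -> (forall x, A x -> a%:E <= f x) ->
  a%:E * mu A <= \int[mu]_x f x.
Proof.
move=> mA a0 f0 fA.
rewrite -integral_cst // integral_mkcond; apply: integral_le_nonneg => x.
  by rewrite patchE; case: ifP => // _; rewrite lee_fin.
by rewrite patchE; case: ifPn => [/set_mem/fA|_].
Qed.

End NonnegativeIntegral.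

Section LebesgueBoxes.
Context {R : realType}.

Lemma lebesgue_rV_ge0 M (A : set 'rV[R]_M) : (0 <= lebesgue_rV A)%E.
Proof.
elim: M A => [|M IH] A /=; first by rewrite lee_fin.
by apply: integral_ge0 => x _; exact: IH.
Qed.

Lemma lebesgue_rV_le M (A B : set 'rV[R]_M) :
  A `<=` B -> (lebesgue_rV A <= lebesgue_rV B)%E.
Proof.
elim: M A B => [|M IH] A B AB /=.
  rewrite lee_fin !indicE ler_nat; case: (boolP (0 \in A)) => [/set_mem/AB B0|//].
  by rewrite mem_set.
apply: integral_le_nonneg => x; first exact: lebesgue_rV_ge0.
by apply: IH => v; exact: AB.
Qed.

(** Half-open companion of [lebesgue_rV_box]: grid cells are half-open in order to be disjoint. The
    section at [x] is a cube of one dimension less, or empty. *)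
Lemma lebesgue_rV_cube (M : nat) (a : 'rV[R]_M) (h : R) : 0 <= h ->
  lebesgue_rV [set v : 'rV[R]_M | forall i, a ord0 i <= v ord0 i < a ord0 i + h] =
  (h ^+ M)%:E.
Proof.
move=> h0; elim: M a => [|M IH] a.
  by rewrite /= indicE mem_set //; case.
pose a' : 'rV[R]_M := \row_j a ord0 (lift ord0 j).
have r0 (x : R) (v : 'rV[R]_M) :
    (row_mx x%:M v : 'rV[R]_(M.+1)) ord0 ord0 = x.
  rewrite (_ : ord0 = lshift M (ord0 : 'I_1)); last exact: val_inj.
  by rewrite (row_mxEl (x%:M : 'M[R]_1)) mxE.
have rS (x : R) (v : 'rV[R]_M) j :
    (row_mx x%:M v : 'rV[R]_(M.+1)) ord0 (lift ord0 j) = v ord0 j.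
  rewrite (_ : lift ord0 j = rshift 1 j); last exact: val_inj.
  by rewrite (row_mxEr (x%:M : 'M[R]_1)).
have sec (x : R) : [set v : 'rV[R]_M | forall i, a ord0 i <=
      (row_mx x%:M v : 'rV[R]_(M.+1)) ord0 i < a ord0 i + h] =
    if x \in `[a ord0 ord0, a ord0 ord0 + h[%R then
      [set v : 'rV[R]_M | forall i, a' ord0 i <= v ord0 i < a' ord0 i + h]
    else set0.
  apply/seteqP; split => v /=.
    move=> hv; have := hv ord0; rewrite r0 in_itv/= => -> i.
    by have := hv (lift ord0 i); rewrite rS !mxE.
  rewrite in_itv/=; case: ifPn => // hx hv i.
  case: (unliftP ord0 i) => [j ->|->]; last by rewrite r0.
  by have := hv j; rewrite rS !mxE.
transitivity (\int[@lebesgue_measure R]_(x in `[a ord0 ord0, (a ord0 ord0 + h)%R[)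
    (h ^+ M)%:E)%E.
  rewrite [RHS]integral_mkcond; apply: eq_integral => x _.
  rewrite patchE sec mem_setE; case: ifPn => _; last exact: lebesgue_rV0.
  exact: IH.
rewrite integral_cst//.
have /= -> := @lebesgue_measure_itv R `[a ord0 ord0, a ord0 ord0 + h[%R.
rewrite lte_fin ltrDl exprS.
case: ltgtP h0 => // [h0|<-] _; last by rewrite mule0 mul0r.
by rewrite -EFinB -EFinM addrAC subrr add0r mulrC.
Qed.

End LebesgueBoxes.

(** * Reduction of the sample to a product law on cells *)

Section DiscreteLaw.
Context {d : measure_display} {T : measurableType d} {R : realType}.
Variable P : probability T R.

Lemma measurable_fiber (F : finType) (phi : T -> F) (E : pred F) :
  (forall f, measurable [set w | phi w = f]) -> measurable [set w | E (phi w)].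
Proof.
move=> mphi; rewrite [X in measurable X](_ : _ =
    [set w | exists f, E f /\ phi w = f]).
  apply: measurable_exists_fin => f; have [Ef|nEf] := boolP (E f).
    rewrite [X in measurable X](_ : _ = [set w | phi w = f]) //.
    by apply/seteqP; split => w /= => [[]|].
  rewrite [X in measurable X](_ : _ = set0) //.
  by apply/seteqP; split => w // [].
by apply/seteqP; split => w /= => [Ew|[f [Ef ->]]//]; exists (phi w).
Qed.

Lemma prob_fiber (F : finType) (phi : T -> F) (p : F -> R) (E : pred F) :
  (forall f, measurable [set w | phi w = f]) ->
  (forall f, P [set w | phi w = f] = (p f)%:E) ->
  P [set w | E (phi w)] = (\sum_(f | E f) p f)%:E.
Proof.
move=> mphi Pphi.
have S s : uniq s -> P [set w | phi w \in s] = (\sum_(f <- s) p f)%:E.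
  elim: s => [_|f s IH /= /andP[fs us]].
    by rewrite big_nil -[RHS](measure0 P); congr (P _); apply/seteqP; split.
  rewrite big_cons EFinD -IH // -Pphi -measureU //.
  - congr (P _); apply/seteqP; split => w /=.
      by rewrite inE => /orP[/eqP|]; [left|right].
    by rewrite inE => -[->|->]; rewrite ?eqxx ?orbT.
  - exact: (measurable_fiber (mem s)).
  - by apply/seteqP; split => w //= [->]; apply/negP.
have := S (enum E) (enum_uniq E); rewrite big_enum /= => <-.
by congr (P _); apply/seteqP; split => w /=; rewrite mem_enum.
Qed.

Context {M n : nat} (xi : 'I_n -> {RV P >-> borel_rV R M}).
Hypothesis xi_indep : mutually_independent xi.
Context {C : finType} (cell : 'rV[R]_M -> C) (q : C -> R).
Hypothesis mcell :
  forall c, @measurable _ (borel_rV R M) [set x : 'rV[R]_M | cell x = c].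
Hypothesis xi_cell : forall i c, P [set w | cell (xi i w) = c] = (q c)%:E.

Definition cells (w : T) : {ffun 'I_n -> C} := [ffun i => cell (xi i w)].

Let cellsE f : [set w | cells w = f] =
  \bigcap_(i in [set` [set: 'I_n]%SET]) xi i @^-1` [set x | cell x = f i].
Proof.
apply/seteqP; split => w /=.
  by move=> <- i _ /=; rewrite ffunE.
by move=> h; apply/ffunP => i; rewrite ffunE; apply: h; rewrite /= inE.
Qed.

Let mxi i c : measurable (xi i @^-1` [set x | cell x = c]).
Proof.
by have := measurable_funP (xi i) measurableT _ (mcell c); rewrite setTI.
Qed.

Let mcells f : measurable [set w | cells w = f].
Proof.
rewrite cellsE; apply: fin_bigcap_measurable => [|i _]; last exact: mxi.
exact: finite_finset.
Qed.

Lemma measurable_cells (E : pred {ffun 'I_n -> C}) :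
  measurable [set w | E (cells w)].
Proof. exact: (measurable_fiber E mcells). Qed.

(** Independence gives every fiber of [cells] the probability [weight q f], so events expressed by
    cells can be computed in the finite product law. *)
Lemma prob_cells (E : pred {ffun 'I_n -> C}) :
  P [set w | E (cells w)] = (pr q E)%:E.
Proof.
apply: (prob_fiber E mcells) => f; rewrite cellsE xi_indep.
  rewrite (eq_bigr (fun i => (q (f i))%:E)); last by move=> i _; exact: xi_cell.
  by rewrite prodEFin; congr (_%:E); apply: eq_bigl => i; rewrite inE.
by move=> i; exact: mcell.
Qed.

(** The total mass is read off from the cell of the first point, hence [0 < n]. *)
Lemma sum_cells : (0 < n)%N -> \sum_c q c = 1.
Proof.
move=> n0; apply: EFin_inj.
rewrite -(probability_setT P) -(@prob_fiber _ (fun w => cell (xi (Ordinal n0) w))) //.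
  by congr (P _); apply/seteqP; split.
by move=> c; exact: mxi.
Qed.

End DiscreteLaw.

(** * Cells, windows and tubes *)

(** One coordinate of [conv_hull_tube], in grid units: [B] and [C] are the corners of the window and
    of the cell of [z], [Y] is the hull point at time [s], and [t] and [p] are [Y] and the path
    corner rounded down. Replacing [s] by [k / Q] moves a point by at most 1, since
    [|C - B| <= Q]. *)
Lemma near_corner_bound (R : realType) (B C b Z Y s k Q t p : R) :
  0 < Q -> 0 <= s -> s <= 1 -> k <= s * Q -> s * Q <= k + 1 ->
  C <= Z -> Z <= C + 1 ->
  (1 - s) * B + s * Z <= Y -> Y <= (1 - s) * (B + b) + s * Z ->
  t <= Y -> Y < t + 1 ->
  B + b <= Q - 1 -> C + 1 <= Q -> 0 <= B -> 0 <= C -> 0 <= b ->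
  p * Q <= (Q - k) * B + k * C < (p + 1) * Q ->
  p < t + 2 /\ t < p + b + 3.
Proof.
move=> Q0 s0 s1 k1 k2 z1 z2 y1 y2 t1 t2 BQ CQ B0 C0 b0 /andP[p1 p2].
have bound (d x : R) : 0 <= d -> d <= 1 -> - Q <= x -> x <= Q -> -Q <= d * x <= Q.
  by move=> d0 d1 x1 x2; apply/andP; split; nra.
have /andP[dev1 dev2] : - Q <= (s * Q - k) * (C - B) <= Q.
  by apply: bound; lra.
have dE : (s * Q - k) * (C - B) =
    Q * ((1 - s) * B + s * C) - ((Q - k) * B + k * C) by ring.
rewrite {}dE in dev1 dev2.
have sZ1 : s * C <= s * Z by rewrite ler_wpM2l.
have sZ2 : s * Z <= s * (C + 1) by rewrite ler_wpM2l.
have sb : (1 - s) * b <= 1 * b by rewrite ler_wpM2r //; lra.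
have Y1 : (1 - s) * B + s * C <= Y by lra.
have Y2 : Y <= (1 - s) * B + s * C + b + 1 by lra.
have Q1 : Q * ((1 - s) * B + s * C) <= Q * Y by rewrite ler_pM2l.
have Q2 : Q * Y <= Q * ((1 - s) * B + s * C + b + 1) by rewrite ler_pM2l.
have Qt1 : Q * t <= Q * Y by rewrite ler_pM2l.
have Qt2 : Q * Y < Q * (t + 1) by rewrite ltr_pM2l.
by split; rewrite -(ltr_pM2l Q0); lra.
Qed.

Section Grid.
Context {R : realType} {M : nat} (o : 'rV[R]_M) (h : R) (N : nat).
Hypothesis h_gt0 : 0 < h.
Implicit Types (x y z : 'rV[R]_M).

Definition gcoord x (i : 'I_M) : R := (x ord0 i - o ord0 i) / h.

Definition in_cell x (c : {ffun 'I_M -> 'I_N.+1}) : bool :=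
  [forall i, (c i)%:R <= gcoord x i < (c i).+1%:R].

(** [None] stands for everything outside the grid. *)
Definition gcell x : option {ffun 'I_M -> 'I_N.+1} := [pick c | in_cell x c].

Lemma gcellP x c : gcell x = Some c <-> in_cell x c.
Proof.
rewrite /gcell; case: pickP => [c' xc'|nc]; last by split => //; rewrite nc.
split => [[<-]//|xc]; congr Some; apply/ffunP => i; apply: val_inj => /=.
have /forallP/(_ i) := xc; have /forallP/(_ i) := xc'.
by move=> /truncn_def <- /truncn_def <-.
Qed.

Lemma gcell_some x : (forall i, 0 <= gcoord x i < N.+1%:R) ->
  gcell x = Some [ffun i => inord (Num.truncn (gcoord x i))].
Proof.
move=> xN; apply/gcellP/forallP => i; have /andP[x0 xi] := xN i.
rewrite ffunE inordK; first exact: truncn_itv.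
by rewrite truncn_lt_nat.
Qed.

Lemma conv_hull_gcone (A : set 'rV[R]_M) (lo hi : 'I_M -> R) z y :
  (forall x, A x -> x = z \/ forall i, lo i <= gcoord x i <= hi i) ->
  conv_hull A y ->
  exists2 s : R, 0 <= s <= 1 & forall i,
    (1 - s) * lo i + s * gcoord z i <= gcoord y i <=
    (1 - s) * hi i + s * gcoord z i.
Proof.
move=> Abox /(@conv_hull_cone _ _ A (fun i => o ord0 i + h * lo i)
  (fun i => o ord0 i + h * hi i) z y)[].
  move=> x /Abox[->|xb]; [by left|right => i].
  have := xb i; rewrite /gcoord ler_pdivlMr // ler_pdivrMr //.
  by rewrite lerBrDl lerBlDl ![h * _]mulrC.
move=> s s01 ys; exists s => // i; have /andP[y1 y2] := ys i.
have gz : z ord0 i = o ord0 i + h * gcoord z i.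
  by rewrite /gcoord mulrC divfK ?gt_eqF // addrC subrK.
rewrite {2 3}/gcoord ler_pdivlMr // ler_pdivrMr //.
rewrite gz in y1 y2; apply/andP; split; rewrite ?lerBrDl ?lerBlDl.
  by apply: le_trans y1; rewrite le_eqVlt; apply/orP; left; apply/eqP; ring.
by apply: le_trans y2 _; rewrite le_eqVlt; apply/orP; left; apply/eqP; ring.
Qed.

Variables (K s0 b : nat).
Hypothesis b_gt0 : (0 < b)%N.
Hypothesis windows_in : (s0 + b * K <= N)%N.
Implicit Type v : {ffun 'I_M -> 'I_K}.

Definition base v (i : 'I_M) : nat := s0 + b * v i.

Definition place v (e : 'I_M -> nat) : option {ffun 'I_M -> 'I_N.+1} :=
  Some [ffun i => inord (base v i + e i)].

Definition win v : {set option {ffun 'I_M -> 'I_N.+1}} :=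
  [set place v (fun i => e i) | e : {ffun 'I_M -> 'I_b}].

Lemma base_lt v i (e : nat) : (e < b)%N -> (base v i + e < N)%N.
Proof.
move=> eb; rewrite /base; have := ltn_ord (v i).
clear -windows_in eb; nia.
Qed.

Let inordE v i (e : nat) : (e < b)%N ->
  nat_of_ord (inord (base v i + e) : 'I_N.+1) = (base v i + e)%N.
Proof. by move=> /(base_lt v i) h'; rewrite inordK // ltnS ltnW. Qed.

Lemma place_inj v (e e' : 'I_M -> nat) : (forall i, e i < b)%N -> (forall i, e' i < b)%N ->
  place v e = place v e' -> e =1 e'.
Proof.
move=> eb e'b [/ffunP E] i; have := congr1 val (E i).
by rewrite !ffunE /= !inordE // => /addnI.
Qed.

Lemma card_win v : #|win v| = (b ^ M)%N.
Proof.
rewrite card_imset; first by rewrite card_ffun !card_ord.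
move=> e e' ee'; apply/ffunP => i; apply: val_inj.
by apply: (place_inj _ _ ee') => // j; exact: ltn_ord.
Qed.

Lemma place_win v (e : 'I_M -> nat) : (forall i, e i < b)%N -> place v e \in win v.
Proof.
move=> eb; apply/imsetP; exists [ffun i => Ordinal (eb i)] => //.
by congr Some; apply/ffunP => i; rewrite !ffunE.
Qed.

Lemma win_disjoint v v' c : c \in win v -> c \in win v' -> v = v'.
Proof.
move=> /imsetP[e _ ->] /imsetP[e' _ [/ffunP E]]; apply/ffunP => i.
apply: val_inj; have := congr1 val (E i).
rewrite !ffunE /= !inordE // /base -!addnA => /addnI.
rewrite ![(b * _)%N]mulnC => /(congr1 (fun k => k %/ b)%N).
by rewrite !divnMDl // !divn_small // !addn0.
Qed.

Lemma gcell_place v (e : 'I_M -> nat) x i : (forall i, e i < b)%N -> gcell x = place v e ->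
  (base v i + e i)%:R <= gcoord x i < (base v i + e i).+1%:R.
Proof.
by move=> eb /gcellP/forallP/(_ i); rewrite !ffunE inordE.
Qed.

Lemma gcell_win v x i : gcell x \in win v ->
  (base v i)%:R <= gcoord x i < (base v i + b)%:R.
Proof.
move=> /imsetP[e _ xe]; have /andP[x1 x2] := gcell_place i (fun i => ltn_ord (e i)) xe.
apply/andP; split; first by apply: le_trans x1; rewrite ler_nat leq_addr.
by apply: lt_le_trans x2 _; rewrite ler_nat -addnS leq_add2l.
Qed.

Lemma win_gcoord v x : (forall i, (base v i)%:R <= gcoord x i < (base v i + b)%:R) ->
  gcell x \in win v.
Proof.
move=> xb; have xtr i : (base v i <= Num.truncn (gcoord x i) < base v i + b)%N.
  have /andP[x1 x2] := xb i; have x0 : 0 <= gcoord x i by exact: le_trans x1.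
  by rewrite truncn_ge_nat // x1 truncn_lt_nat.
rewrite gcell_some.
  pose e i := (Num.truncn (gcoord x i) - base v i)%N.
  rewrite [X in X \in _](_ : _ = place v e).
    by apply: place_win => i; rewrite /e ltn_subLR; have /andP[] := xtr i.
  congr Some; apply/ffunP => i; rewrite !ffunE /e subnKC //.
  by have /andP[] := xtr i.
move=> i; have /andP[x1 x2] := xb i; rewrite (le_trans _ x1) //=.
apply: lt_le_trans x2 _; rewrite ler_nat.
by have := base_lt v i (_ : b.-1 < b)%N; rewrite prednK // => /(_ (leqnn _)); lia.
Qed.

(* A segment from the window v to the cell z stays, at time close to k / (N + 1),
   near the cell with corner [path_corner v z k]; the 2 absorbs roundings. *)
Definition path_corner v (z : {ffun 'I_M -> 'I_N.+1}) (k : 'I_N.+2) i : nat :=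
  ((N.+1 - k) * base v i + k * z i) %/ N.+1.

(** The [b + 5] offsets per axis cover the width of the window and the errors in
    [near_corner_bound]. The tube of [None] is everything, so that [conv_hull_tube] holds for every
    [z]. *)
Definition tube v (z : option {ffun 'I_M -> 'I_N.+1}) :
    {set option {ffun 'I_M -> 'I_N.+1}} :=
  if z is Some z then
    [set Some [ffun i => inord (path_corner v z ke.1 i + ke.2 i - 2)] |
       ke : 'I_N.+2 * {ffun 'I_M -> 'I_(b + 5)}]
  else [set: option {ffun 'I_M -> 'I_N.+1}]%SET.

(** Order [N] cells out of [N^M]: a tube has volume of order [N^(1 - M)], which is [O(1 / n)] once
    [N] is of order [n^(1 / (M - 1))]. *)
Lemma card_tube v (z : {ffun 'I_M -> 'I_N.+1}) : (#|tube v (Some z)| <= N.+2 * (b + 5) ^ M)%N.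
Proof.
apply: leq_trans (leq_imset_card _ _) _.
by rewrite card_prod card_ffun !card_ord.
Qed.

Lemma conv_hull_tube v (A : set 'rV[R]_M) z y :
  (forall x, A x -> x = z \/ gcell x \in win v) ->
  conv_hull A y -> gcell y \in tube v (gcell z).
Proof.
move=> Awin; case zc : (gcell z) => [c|]; last by rewrite inE.
move=> /(@conv_hull_gcone A (fun i => (base v i)%:R) (fun i => (base v i + b)%:R) z y)[].
  move=> x /Awin[->|xv]; [by left|right => i].
  by have /andP[-> /ltW ->] := gcell_win i xv.
move=> s /andP[s_ge0 s_le1] ys.
have NN : (0 : R) < N.+1%:R by rewrite ltr0n.
have czP i : (c i)%:R <= gcoord z i < (c i)%:R + 1.
  by have /gcellP/forallP/(_ i) := zc; rewrite -natr1.
have baseN i : (base v i + b <= N)%N.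
  by have := base_lt v i (_ : b.-1 < b)%N; rewrite prednK // => /(_ (leqnn _)); lia.
have baseNR i : (base v i)%:R + b%:R <= N.+1%:R - 1 :> R.
  by rewrite -natr1 addrK -natrD ler_nat.
have cN i : (c i)%:R + 1 <= N.+1%:R :> R by rewrite natr1 ler_nat.
(* The hull point lies within the grid, so it has a cell. *)
have yN i : 0 <= gcoord y i < N.+1%:R.
  have /andP[y1 y2] := ys i; have /andP[z1 z2] := czP i.
  rewrite natrD in y2.
  apply/andP; split.
    apply: le_trans y1; rewrite addr_ge0 // mulr_ge0 ?subr_ge0 //.
    exact: le_trans z1.
  have := baseNR i; have := cN i; move: y2 z2.
  set B := (base v i)%:R; set Z := gcoord z i; set Y := gcoord y i.
  move=> y2 z2 cN' bN.
  have zN : Z < N.+1%:R by lra.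
  have [s1|s1] := eqVneq s 1; first by move: y2; rewrite s1 subrr mul0r; lra.
  have s_lt1 : s < 1 by rewrite lt_neqAle s1.
  apply: le_lt_trans y2 _.
  have : (1 - s) * (B + b%:R) < (1 - s) * N.+1%:R.
    by rewrite ltr_pM2l ?subr_gt0 //; lra.
  have : s * Z <= s * N.+1%:R by rewrite ler_wpM2l // ltW.
  lra.
rewrite gcell_some //.
(* Time steps of length [1 / N.+1] suffice, as the two ends of a segment differ by at most about
   [N.+1] cells in each coordinate. *)
pose k := Num.truncn (s * N.+1%:R).
have /andP[k1 k2] : k%:R <= s * N.+1%:R < k%:R + 1.
  by rewrite natr1; apply: truncn_itv; rewrite mulr_ge0.
have kN : (k < N.+2)%N.
  rewrite ltnS -(ler_nat R); apply: le_trans k1 _.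
  by rewrite -[leRHS]mul1r ler_pM2r.
pose p i := path_corner v c (Ordinal kN) i.
have near_corner i : (p i <= Num.truncn (gcoord y i) + 2)%N /\
    (Num.truncn (gcoord y i) + 2 < p i + b + 5)%N.
  have /andP[y1 y2] := ys i; have /andP[z1 z2] := czP i.
  have /andP[Y0 YN] := yN i; have /andP[t1 t2] := truncn_itv Y0.
  rewrite natrD in y2; rewrite -natr1 in t2.
  set B : R := (base v i)%:R in y1 y2 *; set C : R := (c i)%:R in z1 z2 *.
  have pE : (p i)%:R * N.+1%:R <= (N.+1%:R - k%:R) * B + k%:R * C < ((p i)%:R + 1) * N.+1%:R.
    have natB : (N.+1 - k)%:R = N.+1%:R - k%:R :> R by rewrite natrB // -ltnS.
    have q1 : (p i * N.+1)%:R <= ((N.+1 - k) * base v i + k * c i)%:R :> R.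
      by rewrite ler_nat leq_trunc_div.
    have q2 : ((N.+1 - k) * base v i + k * c i)%:R < ((p i).+1 * N.+1)%:R :> R.
      by rewrite ltr_nat ltn_ceil.
    rewrite natrD !natrM natB in q1; rewrite natrD !natrM natB in q2.
    by rewrite q1 natr1 q2.
  have BN := baseNR i; have CN := cN i; rewrite -/B -/C in BN CN.
  have B0 : 0 <= B by []; have C0 : 0 <= C by [].
  have [lo hi] := near_corner_bound NN s_ge0 s_le1 k1 (ltW k2) z1 (ltW z2)
    y1 y2 t1 t2 (baseNR i) (cN i) (ler0n _ _) (ler0n _ _) (ler0n _ _) pE.
  split.
    by rewrite -ltnS -(ltr_nat R) -natr1 natrD; lra.
  by rewrite -(ltr_nat R) !natrD; lra.
have eP i : (Num.truncn (gcoord y i) + 2 - p i < b + 5)%N.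
  by have [] := near_corner i; lia.
apply/imsetP; exists (Ordinal kN, [ffun i => Ordinal (eP i)]) => //.
congr Some; apply/ffunP => i; rewrite !ffunE /=; congr inord.
by have [] := near_corner i; rewrite /p; lia.
Qed.

End Grid.

(** [z] and [y] are far points in rows [j] and [j'] of one column. If [y] lies in the cone from [z]
    over the cluster, the first coordinate forces [(1 - s) (3 u + 2) <= 1], so the second
    coordinates differ by at most 1. As rows are spaced by 3, they agree. *)
Lemma far_cells_visible (R : realFieldType) (s m u j j' z0 y0 z1 y1 B0 B1 : R) :
  0 <= s -> s <= 1 -> 0 <= m -> 0 <= j -> j + 1 <= u ->
  z0 <= B0 + (m + 3 * u + 2) -> B0 + (m + 3 * u + 1) <= y0 ->
  y0 <= (1 - s) * (B0 + m) + s * z0 ->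
  B1 + 3 * j <= z1 -> z1 <= B1 + 3 * j + 1 ->
  B1 + 3 * j' <= y1 -> y1 < B1 + 3 * j' + 1 ->
  (1 - s) * B1 + s * z1 <= y1 -> y1 <= (1 - s) * (B1 + 1) + s * z1 ->
  j' < j + 1 /\ j < j' + 1.
Proof.
move=> s_ge0 s_le1 m0 j0 ju z0B y0B y0s z1B z1B' y1B y1B' y1s y1s'.
have r0 : 0 <= 1 - s by rewrite subr_ge0.
have sz0 : s * z0 <= s * (B0 + (m + 3 * u + 2)) by rewrite ler_wpM2l.
have r_small : (1 - s) * (3 * u + 2) <= 1 by lra.
have d1 : (1 - s) * (z1 - B1) <= (1 - s) * (3 * u + 2).
  by rewrite ler_wpM2l //; lra.
have d2 : 0 <= (1 - s) * (z1 - B1) by rewrite mulr_ge0 //; lra.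
by split; lra.
Qed.

(** * A window configuration with prescribed empty simplices *)

Section Template.
Context {M : nat} (N K s0 t : nat).
Hypothesis hM : (2 <= M)%N.

Definition width : nat := (M + 3 * t + 2)%N.

(* M cluster cells in a row along the first axis, and t cells far away along
   that axis, spread along the second one: from a far cell, the cluster hides
   no other far cell. *)
Definition offset (a : 'I_(M + t)) (i : 'I_M) : nat :=
  match fintype.split a, nat_of_ord i with
  | inl a, 0 => a
  | inr j, 0 => (M + 3 * t).+1
  | inr j, 1 => 3 * j
  | _, _ => 0
  end.

Lemma offset_lshift (a : 'I_M) i :
  offset (lshift t a) i = if i == 0%N :> nat then a : nat else 0%N.
Proof. by rewrite /offset (unsplitK (inl a)); case: (nat_of_ord i). Qed.

Lemma offset_rshift (j : 'I_t) i : offset (rshift M j) i =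
  match nat_of_ord i with 0 => (M + 3 * t).+1 | 1 => (3 * j)%N | _ => 0%N end.
Proof. by rewrite /offset (unsplitK (inr j)). Qed.

Lemma offset_lt a i : (offset a i < width)%N.
Proof.
rewrite -[a]splitK /unsplit /width; case: (fintype.split a) => [a'|j].
  by rewrite offset_lshift; have := ltn_ord a'; case: eqP => _; lia.
by rewrite offset_rshift; have := ltn_ord j; case: (nat_of_ord i) => [|[|k]]; lia.
Qed.

Let i0 : 'I_M := Ordinal (ltn_trans (ltnSn 0) hM).
Let i1 : 'I_M := Ordinal hM.

Lemma offset_inj a a' : offset a =1 offset a' -> a = a'.
Proof.
rewrite -[a]splitK -[a']splitK /unsplit.
case: (fintype.split a) => [b|j]; case: (fintype.split a') => [b'|j'] E.
- have := E i0; rewrite !offset_lshift /= => bb'; congr lshift; exact: val_inj.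
- have := E i0; rewrite offset_lshift offset_rshift /=.
  by have := ltn_ord b; lia.
- have := E i0; rewrite offset_lshift offset_rshift /=.
  by have := ltn_ord b'; lia.
- have := E i1; rewrite !offset_rshift /= => jj'; congr rshift.
  by apply: val_inj => /=; lia.
Qed.

Definition tcell (v : {ffun 'I_M -> 'I_K}) (a : 'I_(M + t)) :
  option {ffun 'I_M -> 'I_N.+1} := place N s0 width v (offset a).

Lemma tcell_win v a : tcell v a \in win N s0 width v.
Proof. by apply: place_win => i; exact: offset_lt. Qed.

Hypothesis windows_in : (s0 + width * K <= N)%N.

Lemma tcell_inj v : injective (tcell v).
Proof.
move=> a a' /(place_inj windows_in) E; apply: offset_inj.
by apply: E => i; exact: offset_lt.
Qed.

Context {R : realType} (o : 'rV[R]_M) (h : R) {n : nat} (X : 'I_n -> 'rV[R]_M).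
Hypothesis h_gt0 : 0 < h.

(** The window is a convex box, so a sample point in the simplex of [z] lies in the window and, by
    [occ], is one of the prescribed points. A cluster point is a vertex; another far point is ruled
    out by [far_cells_visible]. *)
Lemma star_template (v : {ffun 'I_M -> 'I_K}) (g : {ffun 'I_(M + t) -> 'I_n}) :
  injective g ->
  occ (win N s0 width) tcell v g [ffun i => gcell o h N (X i)] ->
  star X [set g (lshift t a) | a : 'I_M] [set g (rshift M j) | j : 'I_t].
Proof.
move=> g_inj /andP[/forallP fg /forallP fo].
have cellg a : gcell o h N (X (g a)) = tcell v a.
  by apply/eqP; have := fg a; rewrite ffunE.
have coordg a i := gcell_place windows_in i (offset_lt a) (cellg a).
split.
- rewrite card_imset ?card_ord // => a a' /g_inj; exact: lshift_inj.
- apply/pred0P => i /=; apply/negP => /andP[/imsetP[a _ ->] /imsetP[j _ /g_inj]].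
  by move=> /eqP; rewrite eq_lrshift.
- have codg i : i \in [set g (lshift t a) | a : 'I_M] :|:
      [set g (rshift M j) | j : 'I_t] -> exists a, i = g a.
    by rewrite inE => /orP[] /imsetP[a _ ->]; eexists.
  move=> _ _ /codg[a ->] /codg[a' ->] /(congr1 (gcell o h N)).
  by rewrite !cellg => /tcell_inj ->.
move=> _ /imsetP[j _ ->] i.
set z := X (g (rshift M j)).
have zc k := coordg (rshift M j) k; rewrite -/z in zc.
(* The cluster fits in a box of [M] cells along the first axis and one cell along the others. *)
move=> /(@conv_hull_gcone _ _ o h h_gt0 _ (fun k => (base s0 width v k)%:R)
  (fun k => (base s0 width v k)%:R + (if k == 0%N :> nat then M%:R else 1)) z (X i))[].
  move=> _ [k /= kJ <-]; move: kJ; rewrite inE => /orP[|/imsetP[a _ ->]].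
    by rewrite inE => /eqP ->; left.
  right => k'; have /andP[c1 c2] := coordg (lshift t a) k'.
  rewrite offset_lshift in c1 c2; apply/andP; split.
    by apply: le_trans c1; rewrite ler_nat leq_addr.
  apply: le_trans (ltW c2) _; case: eqP => _; rewrite -?natrD ?natr1 ler_nat.
    by rewrite -addnS leq_add2l.
  by rewrite addn0.
move=> s /andP[s_ge0 s_le1] ys.
have r_ge0 : 0 <= 1 - s by rewrite subr_ge0.
have yv : gcell o h N (X i) \in win N s0 width v.
  apply: win_gcoord => // [|k]; first by rewrite /width addn2.
  have /andP[y1 y2] := ys k; have /andP[z1 z2] := zc k.
  have zB : (base s0 width v k)%:R <= gcoord o h z k.
    by apply: le_trans z1; rewrite ler_nat leq_addr.
  have zW : gcoord o h z k < (base s0 width v k)%:R + width%:R.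
    apply: lt_le_trans z2 _.
    by rewrite -natrD ler_nat -addnS leq_add2l offset_lt.
  have eW : (if k == 0%N :> nat then M%:R else 1) < width%:R :> R.
    by case: ifP => _; rewrite /width ?ltr_nat ?ltr1n; lia.
  move: y1 y2 zB zW eW; rewrite natrD; set B : R := (base _ _ _ _)%:R.
  set e : R := if _ then _ else _; set Z := gcoord o h z k; set Y := gcoord _ _ _ _.
  set w : R := width%:R => y1 y2 zB zW eW.
  apply/andP; split.
    have : s * B <= s * Z by rewrite ler_wpM2l.
    lra.
  have [s1|s_neq1] := eqVneq s 1.
    by move: y2; rewrite s1 subrr mul0r add0r mul1r => /le_lt_trans; apply.
  have : (1 - s) * (B + e) < (1 - s) * (B + w).
    by rewrite ltr_pM2l ?ltrD2l // subr_gt0 lt_neqAle s_neq1.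
  have : s * Z <= s * (B + w) by rewrite ler_wpM2l // ltW.
  lra.
have /codomP[a ia] : i \in codom g.
  by apply: contraT => ig; have := fo i; rewrite ig ffunE yv.
rewrite ia; move: ia; rewrite -[a]splitK /unsplit.
case: (fintype.split a) => [b|j'] ia.
  exists (g (lshift t b)) => //; rewrite in_setU1; apply/orP; right.
  by apply/imsetP; exists b.
have [<-|jj'] := eqVneq j' j; first by exists (g (rshift M j')); rewrite // !inE eqxx.
exfalso; move/eqP: jj'; apply; apply: val_inj => /=.
have y0 := coordg (rshift M j') i0; have y1 := coordg (rshift M j') i1.
rewrite -ia in y0 y1; have z0 := zc i0; have z1 := zc i1.
move: y0 y1 z0 z1 (ys i0) (ys i1); rewrite !offset_rshift /=.
move=> /andP[y0 _] /andP[y1 y1'] /andP[_ z0] /andP[z1 z1'] /andP[_ s0'] /andP[s1 s1'].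
have sh (A k : nat) : (A + 3 * k)%:R = A%:R + 3 * k%:R :> R by rewrite natrD natrM.
have shS (A k : nat) : (A + 3 * k).+1%:R = A%:R + 3 * k%:R + 1 :> R by rewrite -natr1 sh.
have far (A : nat) : (A + (M + 3 * t).+1)%:R = A%:R + (M%:R + 3 * t%:R + 1) :> R.
  by rewrite natrD -natr1 natrD natrM.
have farS (A : nat) : (A + (M + 3 * t).+1).+1%:R = A%:R + (M%:R + 3 * t%:R + 2) :> R.
  by rewrite -natr1 far; ring.
rewrite far in y0; rewrite farS in z0; rewrite sh in y1; rewrite sh in z1.
rewrite shS in y1'; rewrite shS in z1'.
have [] := far_cells_visible (m := M%:R) (u := t%:R) s_ge0 s_le1 (ler0n _ _)
  (ler0n R j) (_ : j%:R + 1 <= t%:R) (ltW z0) y0 s0' z1 (ltW z1') y1 y1' s1 s1'.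
  by rewrite natr1 ler_nat.
by rewrite !natr1 !ltr_nat !ltnS => a1 a2; apply/eqP; rewrite eqn_leq a1 a2.
Qed.

End Template.

(** * Empty simplices from unblocked points *)

Section Unblocked.
Context {R : realType} {M : nat} (o : 'rV[R]_M) (h : R) (N K s0 b : nat).
Hypotheses (h_gt0 : 0 < h) (b_gt0 : (0 < b)%N).
Hypothesis windows_in : (s0 + b * K <= N)%N.
Context {m n : nat} (sub : {ffun 'I_M -> 'I_K} -> 'I_m -> option {ffun 'I_M -> 'I_N.+1}).
Hypotheses (sub_win : forall v a, sub v a \in win N s0 b v)
  (sub_inj : forall v, injective (sub v)) (m_eq : m = M).
Variable X : 'I_n -> 'rV[R]_M.

Definition shadow (v : {ffun 'I_M -> 'I_K}) (z c : option {ffun 'I_M -> 'I_N.+1}) :=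
  c \in tube s0 b v z.

(** A sample point in the simplex of [z] and the cluster has its cell in the tube of [z], so it
    blocks [z] unless it is a vertex. *)
Lemma star_unblocked v (g : {ffun 'I_m -> 'I_n})
    (f := [ffun i => gcell o h N (X i)]) :
  injective g -> occ (win N s0 b) sub v g f ->
  star X [set g a | a : 'I_m]
    (~: [set g a | a : 'I_m] :\: blocked shadow v g f).
Proof.
move=> g_inj /andP[/forallP fg /forallP fo].
have codE i : (i \in [set g a | a : 'I_m]) = (i \in codom g).
  apply/imsetP/codomP => [[a _ ->]|[a ->]]; [by exists a|by exists a].
have cellg a : gcell o h N (X (g a)) = sub v a.
  by apply/eqP; have := fg a; rewrite ffunE.
have hullP z i : z \in ~: [set g a | a : 'I_m] :\: blocked shadow v g f ->
    conv_hull (X @` [set` z |: [set g a | a : 'I_m]]) (X i) ->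
    i \in z |: [set g a | a : 'I_m].
  rewrite !inE codE => /andP[nb zg] hi; apply: contraT; rewrite negb_or codE.
  move=> /andP[iz ig]; move: nb; rewrite zg /= negb_exists => /forallP/(_ i).
  rewrite ig iz /= !ffunE => /negP; case.
  rewrite /shadow; apply: conv_hull_tube hi => // _ [k /= kJ <-].
  move: kJ; rewrite inE => /orP[|/imsetP[a _ ->]].
    by rewrite inE => /eqP ->; left.
  by right; rewrite cellg.
split.
- by rewrite card_imset // card_ord.
- apply/pred0P => i /=; rewrite !inE; case: (i \in _) => //=; by rewrite andbF.
- move=> i j; rewrite ![_ \in _ :|: _]inE => ij jj Xij.
  (* A point that coincides with an unblocked [X i] lies in its simplex and would block it; this
     gives injectivity. *)
  have self k : conv_hull (X @` [set` k |: [set g a | a : 'I_m]]) (X k).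
    by apply: sub_conv_hull; exists k; rewrite //= !inE eqxx.
  have [ig|ig] := boolP (i \in [set g a | a : 'I_m]);
    have [jg|jg] := boolP (j \in [set g a | a : 'I_m]).
  + move: ig jg Xij => /imsetP[a _ ->] /imsetP[a' _ ->].
    by move=> /(congr1 (gcell o h N)); rewrite !cellg => /sub_inj ->.
  + have jc := jg; rewrite codE in jc.
    have := fo j; rewrite jc /= ffunE -Xij; move: ig => /imsetP[a _ ->].
    by rewrite cellg sub_win.
  + have ic := ig; rewrite codE in ic.
    have := fo i; rewrite ic /= ffunE Xij; move: jg => /imsetP[a _ ->].
    by rewrite cellg sub_win.
  + move: ij; rewrite (negbTE ig) /= => iJ.
    have := hullP i j iJ; rewrite -Xij => /(_ (self i)).
    by rewrite inE (negbTE jg) orbF inE => /eqP.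
- by move=> z zJ i hi; exists i => //; exact: hullP.
Qed.

Lemma card_unblocked v (g : {ffun 'I_m -> 'I_n}) f : injective g ->
  (n - m <= #|~: [set g a | a : 'I_m] :\: blocked shadow v g f| +
           #|blocked shadow v g f|)%N.
Proof.
move=> g_inj.
have <- : #|~: [set g a | a : 'I_m]| = (n - m)%N.
  by rewrite cardsCs finset.setCK card_ord card_imset // card_ord.
rewrite -(cardsID (blocked shadow v g f) (~: _)) addnC leq_add2l.
by apply: subset_leq_card; exact: subsetIr.
Qed.

End Unblocked.

(** * Law of the cells *)

Section ConvexBody.
Context {R : realType} {M : nat} (W : set 'rV[R]_M).
Hypothesis W_body : convex_body W.

(** An interior point gives a cube of side [l] inside [W], and compactness bounds [W] by a whole
    number [L] of sides, so that one grid whose mesh divides [l] covers [W] and tiles the inner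
    cube. *)
Lemma convex_body_cube : exists (p : 'rV[R]_M) (l : R) (L : nat),
  [/\ 0 < l,
      forall x : 'rV[R]_M,
        (forall i, p ord0 i <= x ord0 i <= p ord0 i + l) -> W x &
      forall x : 'rV[R]_M, W x ->
        forall i, - (L%:R * l) <= x ord0 i - p ord0 i < L%:R * l].
Proof.
have [cW _ [p pW]] := W_body.
have /nbhs_ballP[e /= e0 eW] : nbhs p W by exact: pW.
have [B [_ WB]] := compact_bounded cW.
pose l := e / 2; have l0 : 0 < l by rewrite divr_gt0.
pose B1 := `|B| + 1 + `|p|.
pose L := (Num.truncn (B1 / l)).+1.
exists p, l, L; split => // x.
  move=> xp; apply: eW; split => // i j; rewrite (ord1 i) /ball /=.
  have /andP[x1 x2] := xp j; rewrite distrC ger0_norm ?subr_ge0 //.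
  by rewrite ltrBlDl (le_lt_trans x2) // ltrD2l /l ltr_pdivrMr // ltr_pMr // ltr1n.
move=> Wx i.
have coord_norm (y : 'rV[R]_M) : `|y ord0 i| <= `|y|.
  rewrite [leRHS]/Num.norm /= mx_normrE; apply/bigmax_geP; right => /=.
  by exists (ord0, i).
have xB : `|x| <= `|B| + 1.
  by apply: WB => //; rewrite (le_lt_trans (ler_norm B)) // ltrDl.
have B1L : B1 < L%:R * l by rewrite -ltr_pdivrMr // truncnS_gt.
have : `|x ord0 i - p ord0 i| < L%:R * l.
  apply: le_lt_trans B1L; apply: le_trans (ler_normB _ _) _.
  by rewrite /B1 lerD // (le_trans _ xB).
by rewrite ltr_norml => /andP[/ltW -> ->].
Qed.

Lemma convex_body_volume : exists2 vol : R, 0 < vol & lebesgue_rV W = vol%:E.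
Proof.
have [p [l [L [l0 pW Wp]]]] := convex_body_cube.
have lo : ((l ^+ M)%:E <= lebesgue_rV W)%E.
  rewrite -(lebesgue_rV_cube p (ltW l0)); apply: lebesgue_rV_le => x /= xp.
  by apply: pW => i; have /andP[-> /ltW ->] := xp i.
have up : (lebesgue_rV W <= ((2 * (L%:R * l)) ^+ M)%:E)%E.
  have Ll : 0 <= 2 * (L%:R * l) by rewrite !mulr_ge0 // ltW.
  rewrite -(lebesgue_rV_cube (\row_i (p ord0 i - L%:R * l)) Ll).
  apply: lebesgue_rV_le => x /Wp xp /= i; have /andP[x1 x2] := xp i.
  by rewrite !mxE; apply/andP; split; lra.
case: (lebesgue_rV W) lo up => [r| |] //.
rewrite !lee_fin => lr _; exists r => //; apply: lt_le_trans lr.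
exact: exprn_gt0.
Qed.

End ConvexBody.

Section CellLaw.
Context {R : realType} {M : nat} (W : set 'rV[R]_M) (p : 'rV[R]_M) (l vol : R) (L : nat).
Hypotheses (l_gt0 : 0 < l) (vol_gt0 : 0 < vol).
Hypothesis volE : lebesgue_rV W = vol%:E.
Hypothesis cube_W : forall x : 'rV[R]_M,
  (forall i, p ord0 i <= x ord0 i <= p ord0 i + l) -> W x.
Hypothesis W_cube : forall x : 'rV[R]_M, W x ->
  forall i, - (L%:R * l) <= x ord0 i - p ord0 i < L%:R * l.
Variables b K : nat.
Hypotheses (b_gt0 : (0 < b)%N) (K_gt0 : (0 < K)%N).

(** The inner cube is cut into [K] windows of [b] cells per axis. The grid starts [L] sides below
    [p], hence [shift] cells before the first window, and extends over [2 L + 1] sides, which covers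
    [W]. *)
Definition mesh : R := l / (b * K)%:R.
Definition origin : 'rV[R]_M := \row_i (p ord0 i - L%:R * l).
Definition shift : nat := (L * (b * K))%N.
Definition grid_size : nat := ((2 * L).+1 * (b * K))%N.

Let bK_gt0 : (0 : R) < (b * K)%:R.
Proof. by rewrite ltr0n muln_gt0 b_gt0. Qed.

Lemma mesh_gt0 : 0 < mesh.
Proof. by rewrite divr_gt0. Qed.

Lemma windows_in_grid : (shift + b * K <= grid_size)%N.
Proof. by rewrite /shift /grid_size addnC -mulSn leq_mul2r ltnS leq_pmull ?orbT. Qed.

Let Cell := option {ffun 'I_M -> 'I_grid_size.+1}.
Let cell : 'rV[R]_M -> Cell := gcell origin mesh grid_size.

Definition cell_prob (z : Cell) : R :=
  if z is Some c then
    fine (lebesgue_rV ([set x | in_cell origin mesh x c] `&` W)) / vol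
  else 0.

(** The mass of a cell inside [W], and an upper bound for the cells that cross its boundary. *)
Definition cell_max : R := mesh ^+ M / vol.

Let in_cellE x (c : {ffun 'I_M -> 'I_grid_size.+1}) :
  in_cell origin mesh x c <->
  forall i, origin ord0 i + (c i)%:R * mesh <= x ord0 i <
            origin ord0 i + (c i)%:R * mesh + mesh.
Proof.
have E i : ((c i)%:R <= gcoord origin mesh x i < (c i).+1%:R) =
    (origin ord0 i + (c i)%:R * mesh <= x ord0 i <
     origin ord0 i + (c i)%:R * mesh + mesh).
  rewrite /gcoord ler_pdivlMr ?mesh_gt0 // ltr_pdivrMr ?mesh_gt0 //.
  by rewrite lerBrDl ltrBlDl -natr1 mulrDl mul1r addrA.
by split => [/forallP h i|h]; [rewrite -E|apply/forallP => i; rewrite E].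
Qed.

Let cell_volume (c : {ffun 'I_M -> 'I_grid_size.+1}) :
  lebesgue_rV [set x | in_cell origin mesh x c] = (mesh ^+ M)%:E.
Proof.
rewrite -(lebesgue_rV_cube (\row_i (origin ord0 i + (c i)%:R * mesh)) (ltW mesh_gt0)).
congr lebesgue_rV; apply/seteqP; split => x /= h.
  by move=> i; have /in_cellE/(_ i) := h; rewrite !mxE.
by apply/in_cellE => i; have := h i; rewrite !mxE.
Qed.

Lemma cell_prob_ge0 z : 0 <= cell_prob z.
Proof.
case: z => [c|] //=; rewrite divr_ge0 ?(ltW vol_gt0) // fine_ge0 //.
exact: lebesgue_rV_ge0.
Qed.

Lemma cell_max_ge0 : 0 <= cell_max.
Proof. by rewrite divr_ge0 ?exprn_ge0 // ltW // mesh_gt0. Qed.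

Lemma cell_prob_le z : cell_prob z <= cell_max.
Proof.
case: z => [c|] /=; last exact: cell_max_ge0.
rewrite ler_pM2r ?invr_gt0 // -lee_fin -(cell_volume c) fineK.
  by apply: lebesgue_rV_le => x [].
rewrite ge0_fin_numE ?lebesgue_rV_ge0 //.
apply: (@le_lt_trans _ _ (mesh ^+ M)%:E); last exact: ltry.
by rewrite -(cell_volume c); apply: lebesgue_rV_le => x [].
Qed.

(** Window cells lie in the inner cube, so [W] does not cut them; this is why all prescribed cells
    have one mass [u] and all windows one mass [w]. *)
Lemma cell_prob_place (v : {ffun 'I_M -> 'I_K}) (e : 'I_M -> nat) : (forall i, e i < b)%N ->
  cell_prob (place grid_size shift b v e : Cell) = cell_max.
Proof.
move=> eb; rewrite /cell_prob /=; set c := [ffun _ => _].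
congr (_ / _); rewrite (_ : _ `&` W = [set x | in_cell origin mesh x c]).
  by rewrite cell_volume.
apply/seteqP; split => [x []//|x xc]; split => //.
have cx : gcell origin mesh grid_size x = place grid_size shift b v e.
  exact/gcellP.
have hK : (b * K)%:R * mesh = l by rewrite /mesh mulrC divfK // gt_eqF.
have h0 := mesh_gt0.
apply: cube_W => i.
have /andP[x1 x2] := gcell_place windows_in_grid i eb cx.
have vK := ltn_ord (v i).
have lo : shift%:R <= gcoord origin mesh x i.
  by apply: le_trans x1; rewrite ler_nat /base -addnA leq_addr.
have up : gcoord origin mesh x i <= shift%:R + (b * K)%:R.
  apply: le_trans (ltW x2) _; rewrite -natrD ler_nat /base.
  rewrite -addnS -addnA leq_add2l; have := eb i.
  clear -vK; move: (e i) (nat_of_ord (v i)) vK => k k' vK kb.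
  by apply: (@leq_trans (b * k'.+1)%N); [rewrite mulnS addnC; lia|rewrite leq_mul2l vK orbT].
move: lo up; rewrite /gcoord ler_pdivlMr // ler_pdivrMr // mulrDl hK.
have -> : shift%:R * mesh = L%:R * l by rewrite /shift natrM -mulrA hK.
by rewrite !mxE => lo up; apply/andP; split; lra.
Qed.

Lemma mass_win (v : {ffun 'I_M -> 'I_K}) :
  mass cell_prob (mem (win grid_size shift b v)) = b%:R ^+ M * cell_max.
Proof.
rewrite /mass (eq_bigr (fun=> cell_max)).
  by rewrite sumr_const -natrX -(card_win windows_in_grid v) mulr_natl.
move=> z /imsetP[e _ ->]; apply: cell_prob_place => i; exact: ltn_ord.
Qed.

Lemma mass_tube (v : {ffun 'I_M -> 'I_K}) (z : Cell) :
  cell_prob z * mass cell_prob (mem (tube shift b v z)) <=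
  cell_prob z * ((grid_size.+2 * (b + 5) ^ M)%:R * cell_max).
Proof.
case: z => [c|]; last by rewrite /= !mul0r.
apply: ler_wpM2l; first exact: cell_prob_ge0.
apply: (@le_trans _ _ (\sum_(z in tube shift b v (Some c)) cell_max)).
  by apply: ler_sum => z _; exact: cell_prob_le.
rewrite sumr_const -[X in X <= _]mulr_natl ler_wpM2r ?cell_max_ge0 // ler_nat.
exact: card_tube.
Qed.

Lemma measurable_in_cell (c : {ffun 'I_M -> 'I_grid_size.+1}) :
  @measurable _ (borel_rV R M) [set x | in_cell origin mesh x c].
Proof.
rewrite [X in measurable X](_ : _ = [set x : borel_rV R M | forall i : 'I_M,
    origin ord0 i + (c i)%:R * mesh <= (x : 'rV[R]_M) ord0 i <
    origin ord0 i + (c i)%:R * mesh + mesh]).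
  apply: measurable_forall_fin => i.
  have mc := @measurable_borel_coord R M i.
  have := mc measurableT `[origin ord0 i + (c i)%:R * mesh,
    (origin ord0 i + (c i)%:R * mesh + mesh)%R[%classic (measurable_itv _).
  by rewrite setTI; congr measurable; apply/seteqP; split => x /=; rewrite in_itv.
by apply/seteqP; split => x /= /in_cellE.
Qed.

Lemma measurable_cell (z : Cell) : @measurable _ (borel_rV R M) [set x | cell x = z].
Proof.
case: z => [c|].
  rewrite [X in measurable X](_ : _ = [set x | in_cell origin mesh x c]).
    exact: measurable_in_cell.
  by apply/seteqP; split => x /= /gcellP.
rewrite [X in measurable X](_ : _ = [set x : borel_rV R M |
    forall c : {ffun 'I_M -> 'I_grid_size.+1}, (~` [set x | in_cell origin mesh x c]) x]).
  by apply: measurable_forall_fin => c; apply: measurableC; exact: measurable_in_cell.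
apply/seteqP; split => x /=.
  by move=> xN c /gcellP; rewrite -/cell xN.
move=> h; case E : (cell x) => [c|//]; case: (h c); exact/gcellP.
Qed.

Context {d : measure_display} {T : measurableType d} (P : probability T R).

Lemma prob_cell (X : {RV P >-> borel_rV R M}) (z : Cell) : uniform_on W X ->
  P [set w | cell (X w) = z] = (cell_prob z)%:E.
Proof.
move=> unifX; have := unifX _ (measurable_cell z).
rewrite (_ : X @^-1` _ = [set w | cell (X w) = z]) // => ->.
rewrite volE /=; case: z => [c|] /=.
  congr (fine (lebesgue_rV _) / _)%:E; apply/seteqP.
  by split => x /= [xc Wx]; split => //; exact/gcellP.
rewrite (_ : _ `&` W = set0) ?lebesgue_rV0 ?mul0r //.
apply/seteqP; split => // x /= [xN Wx].
have h0 := mesh_gt0.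
have hK : (b * K)%:R * mesh = l by rewrite /mesh mulrC divfK // gt_eqF.
move: xN; rewrite /cell gcell_some // => i.
rewrite /gcoord !mxE divr_ge0 ?(ltW h0) //=; last first.
  by have /andP[x1 x2] := W_cube Wx i; lra.
rewrite ltr_pdivrMr //.
apply: (@lt_le_trans _ _ (grid_size%:R * mesh)); last first.
  by rewrite ler_pM2r // ler_nat.
rewrite /grid_size natrM -mulrA hK -natr1 natrM.
have /andP[x1 x2] := W_cube Wx i.
have l0 := l_gt0; rewrite mulrDl mul1r -mulrA; lra.
Qed.

End CellLaw.

(** * Degree bounds in terms of the window parameters *)

Section DegreeProbability.
Context {R : realType} {M : nat} (W : set 'rV[R]_M) (p : 'rV[R]_M) (l vol : R) (L : nat).
Hypotheses (l_gt0 : 0 < l) (vol_gt0 : 0 < vol).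
Hypothesis volE : lebesgue_rV W = vol%:E.
Hypothesis cube_W : forall x : 'rV[R]_M,
  (forall i, p ord0 i <= x ord0 i <= p ord0 i + l) -> W x.
Hypothesis W_cube : forall x : 'rV[R]_M, W x ->
  forall i, - (L%:R * l) <= x ord0 i - p ord0 i < L%:R * l.
Hypothesis hM : (2 <= M)%N.
Context {d : measure_display} {T : measurableType d} (P : probability T R) {n : nat}
  (xi : 'I_n -> {RV P >-> borel_rV R M}).
Hypotheses (unif_xi : forall i, uniform_on W (xi i))
  (indep_xi : mutually_independent xi) (n_gt0 : (0 < n)%N).
Variables (t K : nat).
Hypothesis K_gt0 : (0 < K)%N.

Let b := @width M t.
Let m := (M + t)%N.
Let N := grid_size L b K.
Let u : R := @cell_max R M l vol b K.
Let w : R := b%:R ^+ M * u.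
Let q := @cell_prob R M W p l vol L b K.
Let cell := gcell (origin p l L) (mesh l b K) N.
Let b_gt0 : (0 < b)%N. Proof. by rewrite /b /width addn2. Qed.
Let X (x : T) (i : 'I_n) : 'rV[R]_M := xi i x.

Let mcell (z : option {ffun 'I_M -> 'I_N.+1}) :
  @measurable _ (borel_rV R M) [set x | cell x = z].
Proof. exact: (measurable_cell p l_gt0 b_gt0 K_gt0 z). Qed.

Let pcell i z : P [set x | cell (xi i x) = z] = (q z)%:E.
Proof. exact: (prob_cell l_gt0 volE W_cube b_gt0 K_gt0). Qed.

Let win := @win M N K (shift L b K) b.
Let sub := @tcell M N K (shift L b K) t.

Hypothesis w_lt1 : w < 1.

Let lam : R := (#|{ffun 'I_M -> 'I_K}| * n ^_ m)%:R * (u ^+ m * (1 - w) ^+ (n - m)).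
Let rho : R := (1 - w) ^- (m + m).

Let q_ge0 z : 0 <= q z.
Proof. exact: cell_prob_ge0. Qed.

Let q_sum1 : \sum_z q z = 1.
Proof. exact: (sum_cells mcell pcell n_gt0). Qed.

Let windows_in := windows_in_grid L b K.

Let q_sub v a : q (sub v a) = u.
Proof. by apply: cell_prob_place => // i; exact: offset_lt. Qed.

Let q_win v : mass q (mem (win v)) = w.
Proof. exact: mass_win. Qed.

Let occ_exists th c E := @pr_occ_exists R _ _ n m q q_ge0 q_sum1 win sub u w
  (win_disjoint b_gt0 windows_in) (tcell_win _ _ hM) (tcell_inj hM windows_in)
  q_sub q_win w_lt1 th c E.

Let cellsE x : cells xi cell x = [ffun i => cell (X x i)].
Proof. by []. Qed.

(** An occupied window certifies degree [t] by [star_template], so all of [occ] is kept and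
    [th = 1]. *)
Lemma prob_degree_ge (c : R) : 0 <= c ->
  ((2 * c * lam - c ^+ 2 * (lam + rho * lam ^+ 2))%:E <=
   P [set x | (t <= degree (point_set xi x))%N])%E.
Proof.
move=> c0.
pose F f := [exists v, exists g : {ffun 'I_m -> 'I_n}, injectiveb g && occ win sub v g f].
apply: (@le_trans _ _ (pr q F)%:E).
  rewrite lee_fin -[X in 2 * c * X]mul1r.
  by apply: (@occ_exists 1 c (occ win sub)) => // v g _; rewrite mul1r.
rewrite -(prob_cells indep_xi mcell pcell); apply: le_measure; [apply/mem_set|apply/mem_set|].
- exact: (measurable_cells xi mcell F).
- exact: measurable_degree_ge.
move=> x /= /existsP[v /existsP[g /andP[/injectiveP g_inj]]].
rewrite cellsE => vg; have := star_template hM windows_in (mesh_gt0 l_gt0 b_gt0 K_gt0) g_inj vg.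
move=> /star_degree; rewrite card_imset ?card_ord //.
by move=> j j' /g_inj; exact: rshift_inj.
Qed.

(** By the bound on the tubes, blocking costs at most [u^m / 4], which is at most half of the
    probability of [occ]; so [th = 1 / 2]. At least [n - M - n / 2 >= n / 4] points then stay
    unblocked. *)
Lemma prob_degree_linear (c : R) : 0 <= c -> t = 0%N -> (4 * M <= n)%N ->
  1 / 2 <= (1 - w) ^+ (n - m) ->
  2 * n%:R * ((N.+2 * (b + 5) ^ M)%:R * u) <= 4^-1 ->
  ((c * lam - c ^+ 2 * (lam + rho * lam ^+ 2))%:E <=
   P [set x | (n <= 4 * degree (point_set xi x))%N])%E.
Proof.
move=> c0 t0 Mn wn tau_small.
have mM : m = M by rewrite /m t0 addn0.
pose E v (g : {ffun 'I_m -> 'I_n}) f := occ win sub v g f &&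
  (#|blocked (shadow (shift L b K) b) v g f| * 2 <= n)%N.
have u_ge0 : 0 <= u by exact: cell_max_ge0.
pose F f := [exists v, exists g : {ffun 'I_m -> 'I_n}, injectiveb g && E v g f].
apply: (@le_trans _ _ (pr q F)%:E).
  rewrite lee_fin (_ : c * lam = 2 * c * (1 / 2 * lam)); last by field.
  apply: (@occ_exists (1 / 2) c E c0) => [v g f /andP[]//|v g g_inj].
  apply: le_trans (pr_occ_unblocked q_ge0 q_sum1 win q_sub
    (mass_tube W p l_gt0 vol_gt0 b_gt0 K_gt0) v g_inj).
  rewrite (pr_occ q_sum1 q_sub q_win _ g_inj).
  have um : 0 <= u ^+ m by rewrite exprn_ge0.
  have : u ^+ m * (1 / 2) <= u ^+ m * (1 - w) ^+ (n - m) by rewrite ler_wpM2l.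
  have := ler_wpM2l um tau_small.
  set tau := _ * u in tau_small *; rewrite -/u.
  have -> : 2 * n%:R * (u ^+ m * tau) = u ^+ m * (2 * n%:R * tau) by ring.
  lra.
rewrite -(prob_cells indep_xi mcell pcell); apply: le_measure; [apply/mem_set|apply/mem_set|].
- exact: (measurable_cells xi mcell F).
(* [(n + 3) %/ 4] is [n / 4] rounded up. *)
- rewrite (_ : [set x | _] = [set x | ((n + 3) %/ 4 <= degree (point_set xi x))%N]).
    exact: measurable_degree_ge.
  by apply/seteqP; split => x /=; lia.
move=> x /= /existsP[v /existsP[g /andP[/injectiveP g_inj /andP[]]]].
rewrite cellsE => vg blk.
have := star_unblocked (mesh_gt0 l_gt0 b_gt0 K_gt0) b_gt0 windows_in
  (tcell_win _ _ hM) (tcell_inj hM windows_in) mM g_inj vg.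
move=> /star_degree.
have := card_unblocked (shift L b K) b v [ffun i => cell (X x i)] g_inj.
move: (#|blocked _ _ _ _|) (#|_ :\: _|) (degree _) blk mM Mn => B J D; clear; lia.
Qed.

End DegreeProbability.

(** * Asymptotics *)

Section Estimates.
Context {R : realType}.
Implicit Types (x w u : R).

(** For the least admissible value the predecessor fails, and passing from [K >= 1] to
    [K + 1 <= 2 K] costs at most the factor [2^(e + 1)]. *)
Lemma exists_scale (e : nat) x : 1 <= x ->
  exists2 K : nat, (0 < K)%N & x <= (K ^ e.+1)%:R <= 2 ^+ e.+1 * x.
Proof.
move=> x1; have x0 : 0 < x by exact: lt_le_trans x1.
have exK : exists K, x <= (K ^ e.+1)%:R.
  exists (Num.truncn x).+1; apply: le_trans (ltW (truncnS_gt x)) _.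
  by rewrite ler_nat -{1}[(_.+1)%N]expn1 leq_pexp2l.
case: (ex_minnP exK) => -[|K] Kx Kmin.
  by move: Kx; rewrite exp0n // leNgt x0.
exists K.+1 => //; rewrite Kx /=; have [->|K0] := posnP K.
  by rewrite exp1n (le_trans x1) // ler_peMl ?(ltW x0) // exprn_ege1 // ler1n.
apply: (@le_trans _ _ ((2 * K) ^ e.+1)%:R).
  by rewrite ler_nat leq_exp2r // mul2n -addnn -addn1 leq_add2l.
rewrite expnMn natrM natrX ler_pM2l ?exprn_gt0 //.
rewrite leNgt; apply/negP => /ltW /Kmin; by rewrite ltnn.
Qed.

Lemma bernoulli_ineq w (n : nat) : 0 <= w <= 1 -> 1 - n%:R * w <= (1 - w) ^+ n.
Proof.
move=> /andP[w0 w1]; elim: n => [|n IH]; first by rewrite mul0r subr0 expr0.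
have w1' : 0 <= 1 - w by rewrite subr_ge0.
rewrite exprS; apply: le_trans (ler_wpM2l w1' IH); rewrite -natr1.
have : 0 <= n%:R * (w * w) by rewrite !mulr_ge0.
by lra.
Qed.

Lemma power_ge_half w (n k : nat) : 0 <= w -> n%:R * w <= 1 / 2 -> (k <= n)%N ->
  (0 < n)%N -> 1 / 2 <= (1 - w) ^+ k.
Proof.
move=> w0 nw kn n0.
have w1 : w <= 1.
  have : 1 * w <= n%:R * w by rewrite ler_wpM2r // ler1n.
  lra.
have kw : k%:R * w <= n%:R * w by rewrite ler_wpM2r // ler_nat.
by apply: le_trans (bernoulli_ineq k _); [lra|rewrite w0].
Qed.

Lemma power_inv_le w (k : nat) : 0 <= w <= 1 -> k%:R * w <= 1 / 2 ->
  (1 - w) ^- k <= 1 + 2 * (k%:R * w).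
Proof.
move=> /andP[w0 w1] kw; have B := bernoulli_ineq k (introT andP (conj w0 w1)).
have kw0 : 0 <= k%:R * w by rewrite mulr_ge0.
set y := k%:R * w in kw kw0 B *.
have y1 : 0 < 1 - y by lra.
apply: (@le_trans _ _ (1 - y)^-1).
  by rewrite lef_pV2 ?posrE //; exact: lt_le_trans B.
by rewrite invf_ple ?posrE //; [rewrite -div1r ler_pdivrMr //; nra|lra].
Qed.

Lemma ffact_ge (n m : nat) : ((n - m) ^ m <= n ^_ m)%N.
Proof.
elim: m => [|m IH]; first by rewrite expn0.
rewrite ffactnSr expnSr leq_mul ?leq_sub2l //.
apply: leq_trans IH; have [->//|m0] := posnP m.
by rewrite leq_exp2r // leq_sub2l.
Qed.

(** With [2 m <= n] there are at least [(n / 2)^m] injections, and [n w <= 1 / 2] lets the other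
    points avoid the window with probability at least [1 / 2]. *)
Lemma expected_count_ge u w (k n m : nat) : 0 <= u -> 0 <= w ->
  n%:R * w <= 1 / 2 -> (2 * m <= n)%N -> (0 < n)%N ->
  k%:R * (n%:R / 2 * u) ^+ m / 2 <=
  (k * n ^_ m)%:R * (u ^+ m * (1 - w) ^+ (n - m)).
Proof.
move=> u0 w0 nw mn n0.
have half := power_ge_half w0 nw (leq_subr m n) n0.
have ff : (n%:R / 2) ^+ m <= (n ^_ m)%:R :> R.
  apply: (@le_trans _ _ ((n - m) ^ m)%:R); last by rewrite ler_nat ffact_ge.
  rewrite natrX; apply: lerXn2r; rewrite ?nnegrE ?divr_ge0 //.
  by rewrite ler_pdivrMr // -natrM ler_nat; lia.
rewrite natrM exprMn -!mulrA; apply: ler_wpM2l => //.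
have um0 : 0 <= u ^+ m by rewrite exprn_ge0.
apply: ler_pM => //; rewrite ?exprn_ge0 ?divr_ge0 //.
by apply: ler_wpM2l => //; rewrite -div1r.
Qed.

End Estimates.

Section DegreeAsymptotics.
Context {R : realType} {M : nat} (hM : (2 <= M)%N) (W : set 'rV[R]_M).
Hypothesis W_body : convex_body W.

Let cell_maxE (l vol : R) (b K : nat) : (0 < b)%N -> (0 < K)%N ->
  @cell_max R M l vol b K = (l / b%:R) ^+ M / vol / (K ^ M)%:R.
Proof.
move=> b0 K0; rewrite /cell_max /mesh natrM natrX invfM mulrA [(_ / K%:R) ^+ M]exprMn.
by rewrite exprVn -!mulrA [_^-1 * _^-1]mulrC.
Qed.

(** With order [n] windows, each of mass of order [1 / n], the expected count [lam] is at least
    linear in [n] and [rho] is [1 + O(1 / n)]. At [c = lam^-1] the second moment bound is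
    [2 - lam^-1 - rho]. *)
Lemma degree_ge_prob (t : nat) : exists (B : R) (n0 : nat),
  forall (n : nat), (n0 <= n)%N ->
  forall d (T : measurableType d) (P : probability T R)
    (xi : 'I_n -> {RV P >-> borel_rV R M}),
  (forall i, uniform_on W (xi i)) -> mutually_independent xi ->
  ((1 - B / n%:R)%:E <= P [set x | (t <= degree (point_set xi x))%N])%E.
Proof.
have [p [l [L [l0 cube_W W_cube]]]] := convex_body_cube W_body.
have [vol vol0 volE] := convex_body_volume W_body.
pose b := @width M t; have b0 : (0 < b)%N by rewrite /b /width addn2.
have bR : (0 : R) < b%:R by rewrite ltr0n.
pose m := (M + t)%N.
(* The masses of a cell and of a window, multiplied by the number [K^M] of windows. *)
pose u1 := (l / b%:R) ^+ M / vol; pose w1 := b%:R ^+ M * u1.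
have u1_gt0 : 0 < u1 by rewrite !divr_gt0 // exprn_gt0 // divr_gt0.
have w1_gt0 : 0 < w1 by apply: mulr_gt0 => //; exact: exprn_gt0.
(* The term [2 * w1] gives [n w <= 1 / 2]; the 1 gives [1 <= A n], which [exists_scale] requires. *)
pose A := 2 * w1 + 1; have A1 : 1 <= A by rewrite lerDr mulr_ge0 // ltW.
have A0 : 0 < A by exact: lt_le_trans A1.
(* A lower bound for [n u / 2], as [K^M] is at most [2^M A n]. *)
pose be := u1 / (2 ^+ M * A) / 2.
have be0 : 0 < be.
  do 2 apply: divr_gt0 => //; by rewrite mulr_gt0 // exprn_gt0.
exists (2 / be ^+ m + 2 * m%:R), (2 * m).+1 => n mn d T P xi unif_xi indep_xi.
have n0 : (0 < n)%N by exact: leq_trans mn.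
have n1 : (1 : R) <= n%:R by rewrite ler1n.
have nR : (0 : R) < n%:R by rewrite ltr0n.
have An1 : 1 <= A * n%:R.
  by rewrite -[leLHS]mulr1 ler_pM.
have [K K0] := exists_scale M.-1 An1.
rewrite prednK ?(leq_trans _ hM) // => /andP[AK KA].
have KR : (0 : R) < (K ^ M)%:R by rewrite ltr0n expn_gt0 K0.
pose u : R := @cell_max R M l vol b K.
have uE : u = u1 / (K ^ M)%:R by rewrite /u cell_maxE.
pose w := b%:R ^+ M * u; have wE : w = w1 / (K ^ M)%:R by rewrite /w uE mulrA.
have u_ge0 : 0 <= u by rewrite uE divr_ge0 // ltW.
have w_ge0 : 0 <= w by rewrite wE divr_ge0 // ltW.
have nw : n%:R * w <= 1 / 2.
  rewrite wE mulrA ler_pdivrMr //.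
  apply: (@le_trans _ _ (1 / 2 * (A * n%:R))); last by rewrite ler_wpM2l.
  by rewrite /A; nra.
have w_half : w <= 1 / 2.
  by apply: le_trans nw; rewrite ler_peMl.
have := @prob_degree_ge R M W p l vol L l0 vol0 volE cube_W W_cube hM d T P n xi
  unif_xi indep_xi n0 t K K0.
rewrite -/b -/m -/u -/w card_ffun !card_ord.
set lam := (_ * _)%:R * _; set rho := (1 - w) ^- _ => H.
have be_le : be <= n%:R / 2 * u.
  have -> : n%:R / 2 * u = n%:R * u / 2 by ring.
  rewrite /be ler_pM2r ?invr_gt0 // uE mulrA ler_pdivlMr // mulrAC.
  rewrite ler_pdivrMr ?mulr_gt0 ?exprn_gt0 //.
  have -> : n%:R * u1 * (2 ^+ M * A) = u1 * (2 ^+ M * (A * n%:R)) by ring.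
  by rewrite ler_pM2l.
have lam_ge : n%:R * be ^+ m / 2 <= lam.
  apply: le_trans (@expected_count_ge R u w (K ^ M) n m u_ge0 w_ge0 nw _ n0); last exact: ltnW.
  rewrite ler_pM2r ?invr_gt0 //; apply: ler_pM => //.
  - by rewrite exprn_ge0 // ltW.
  - by apply: le_trans AK; rewrite ler_peMl // ltW.
  by apply: lerXn2r => //; rewrite nnegrE ltW // (lt_le_trans be0).
have lam0 : 0 < lam.
  by apply: lt_le_trans lam_ge; rewrite divr_gt0 // mulr_gt0 // exprn_gt0.
have rho_le : rho <= 1 + 2 * m%:R / n%:R.
  have mw : (m + m)%:R * w <= m%:R / n%:R.
    rewrite ler_pdivlMr // addnn -muln2 natrM.
    have : m%:R * (n%:R * w) <= m%:R * (1 / 2) by rewrite ler_wpM2l.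
    by lra.
  have mn2 : m%:R / n%:R <= 1 / 2 :> R.
    rewrite ler_pdivrMr //; have : (2 * m)%:R <= n%:R :> R by rewrite ler_nat ltnW.
    by rewrite natrM; lra.
  apply: le_trans (power_inv_le _ (le_trans mw mn2)) _.
    by rewrite w_ge0 /=; lra.
  by rewrite lerD2l -mulrA ler_wpM2l.
apply: le_trans (H _ lam^-1 _); [|lra|by rewrite invr_ge0 ltW].
rewrite lee_fin.
have -> : 2 * lam^-1 * lam - lam^-1 ^+ 2 * (lam + rho * lam ^+ 2) =
  2 - lam^-1 - rho by field; rewrite gt_eqF.
have laminv : lam^-1 <= 2 / be ^+ m / n%:R.
  have -> : 2 / be ^+ m / n%:R = (n%:R * be ^+ m / 2)^-1.
    by field; rewrite !gt_eqF // exprn_gt0.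
  by rewrite lef_pV2 ?posrE // divr_gt0 // mulr_gt0 // exprn_gt0.
by rewrite [X in 1 - X]mulrDl; lra.
Qed.

(** Here [K^(M - 1)] is of order [n], so tubes have mass [O(1 / n)]. The expected count stays above
    the constant [c3], because [K^M (n u / 2)^M = (K n u / 2)^M]. *)
Lemma degree_linear_prob : exists (D : R) (n0 : nat), 0 < D /\
  forall (n : nat), (n0 <= n)%N ->
  forall d (T : measurableType d) (P : probability T R)
    (xi : 'I_n -> {RV P >-> borel_rV R M}),
  (forall i, uniform_on W (xi i)) -> mutually_independent xi ->
  (D%:E <= P [set x | (n <= 4 * degree (point_set xi x))%N])%E.
Proof.
have [p [l [L [l0 cube_W W_cube]]]] := convex_body_cube W_body.
have [vol vol0 volE] := convex_body_volume W_body.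
pose b := @width M 0; have b0 : (0 < b)%N by rewrite /b /width addn2.
have bR : (0 : R) < b%:R by rewrite ltr0n.
pose m := (M + 0)%N; have mM : m = M by rewrite /m addn0.
pose u1 := (l / b%:R) ^+ M / vol; pose w1 := b%:R ^+ M * u1.
have u1_gt0 : 0 < u1 by rewrite !divr_gt0 // exprn_gt0 // divr_gt0.
have w1_gt0 : 0 < w1 by apply: mulr_gt0 => //; exact: exprn_gt0.
(* A bound for the mass of a tube, multiplied by [K^(M - 1)]. *)
pose Ct : R := (((2 * L).+1 * b + 2) * (b + 5) ^ M)%:R * u1.
have Ct0 : 0 <= Ct by rewrite mulr_ge0 // ltW.
(* [8 * Ct] yields [tau_small]; the other terms serve [n w <= 1 / 2] and [exists_scale]. *)
pose A := 2 * w1 + 8 * Ct + 1.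
have A1 : 1 <= A by rewrite lerDr addr_ge0 // mulr_ge0 // ltW.
have A0 : 0 < A by exact: lt_le_trans A1.
pose be := u1 / (2 ^+ M.-1 * A) / 2.
have be0 : 0 < be.
  do 2 apply: divr_gt0 => //; by rewrite mulr_gt0 // exprn_gt0.
pose c3 := be ^+ M / 2; have c30 : 0 < c3 by rewrite divr_gt0 // exprn_gt0.
(* The value at [c3] of [lam / (4 (1 + 2 lam))], which increases with [lam]. *)
exists (c3 / (4 * (1 + 2 * c3))), (4 * M).+1; split.
  by rewrite divr_gt0 // mulr_gt0 // addr_gt0 // mulr_gt0.
move=> n mn d T P xi unif_xi indep_xi.
have n0 : (0 < n)%N by exact: leq_trans mn.
have n1 : (1 : R) <= n%:R by rewrite ler1n.
have nR : (0 : R) < n%:R by rewrite ltr0n.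
have An1 : 1 <= A * n%:R by rewrite -[leLHS]mulr1 ler_pM.
have [K K0] := exists_scale M.-2 An1.
have M1 : M.-2.+1 = M.-1 by case: (M) hM => [|[|k]].
rewrite M1 => /andP[AK KA].
have Q0 : (0 : R) < (K ^ M.-1)%:R by rewrite ltr0n expn_gt0 K0.
have K1 : (1 : R) <= K%:R by rewrite ler1n.
have KM : (K ^ M)%:R = K%:R * (K ^ M.-1)%:R :> R.
  by rewrite -natrM -expnS prednK // (leq_trans _ hM).
have KR : (0 : R) < (K ^ M)%:R by rewrite ltr0n expn_gt0 K0.
have QK : (K ^ M.-1)%:R <= (K ^ M)%:R :> R by rewrite KM ler_peMl.
pose u : R := @cell_max R M l vol b K.
have uE : u = u1 / (K ^ M)%:R by rewrite /u cell_maxE.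
pose w := b%:R ^+ M * u; have wE : w = w1 / (K ^ M)%:R by rewrite /w uE mulrA.
have u_ge0 : 0 <= u by rewrite uE divr_ge0 // ltW.
have w_ge0 : 0 <= w by rewrite wE divr_ge0 // ltW.
have nw : n%:R * w <= 1 / 2.
  rewrite wE mulrA ler_pdivrMr //.
  apply: (@le_trans _ _ (1 / 2 * (A * n%:R))); last first.
    by rewrite ler_wpM2l // (le_trans AK).
  have : 0 <= Ct * n%:R by rewrite mulr_ge0.
  by rewrite /A; lra.
have w_half : w <= 1 / 2.
  by apply: le_trans nw; rewrite ler_peMl.
have tau_small : 2 * n%:R * (((grid_size L b K).+2 * (b + 5) ^ M)%:R * u) <= 4^-1.
  have tauE : ((grid_size L b K).+2 * (b + 5) ^ M)%:R * u <= Ct / (K ^ M.-1)%:R.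
    rewrite uE mulrA ler_pdivrMr // /Ct KM.
    have -> : ((((2 * L).+1 * b + 2) * (b + 5) ^ M)%:R * u1 / (K ^ M.-1)%:R *
        (K%:R * (K ^ M.-1)%:R)) =
        (((2 * L).+1 * b + 2) * (b + 5) ^ M * K)%:R * u1.
      by rewrite [in RHS]natrM; field; rewrite gt_eqF.
    rewrite ler_pM2r // ler_nat /grid_size mulnAC leq_mul2r; apply/orP; right.
    by rewrite mulnDl -addn2 mulnA leq_add2l leq_pmulr.
  apply: le_trans (_ : 2 * n%:R * (Ct / (K ^ M.-1)%:R) <= _).
    by rewrite ler_wpM2l // mulr_ge0.
  rewrite mulrA ler_pdivrMr //.
  apply: (@le_trans _ _ (4^-1 * (A * n%:R))); last by rewrite ler_wpM2l.
  have : 0 <= w1 * n%:R by rewrite mulr_ge0 // ltW.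
  by rewrite /A; lra.
have := @prob_degree_linear R M W p l vol L l0 vol0 volE cube_W W_cube hM d T P n xi
  unif_xi indep_xi n0 0 K K0.
rewrite -/b -/m -/u -/w card_ffun !card_ord.
set lam := (_ * n ^_ m)%:R * _; set rho := (1 - w) ^- _ => H.
have nuE : n%:R / 2 * u = n%:R * u1 / 2 / (K ^ M)%:R by rewrite uE; ring.
have lam_ge : c3 <= lam.
  apply: le_trans (@expected_count_ge R u w (K ^ M) n m u_ge0 w_ge0 nw _ n0); last first.
    by rewrite mM (leq_trans _ (ltnW mn)) // leq_mul2r orbT.
  rewrite /c3 ler_pM2r ?invr_gt0 // mM natrX -exprMn; apply: lerXn2r.
  - by rewrite nnegrE ltW.
  - by rewrite nnegrE mulr_ge0 // mulr_ge0 // divr_ge0.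
  rewrite nuE KM.
  have -> : K%:R * (n%:R * u1 / 2 / (K%:R * (K ^ M.-1)%:R)) =
      n%:R * u1 / (K ^ M.-1)%:R / 2.
    by field; rewrite !gt_eqF // ltr0n.
  rewrite /be ler_pM2r ?invr_gt0 // ler_pdivlMr // mulrAC.
  rewrite ler_pdivrMr ?mulr_gt0 ?exprn_gt0 //.
  have -> : n%:R * u1 * (2 ^+ M.-1 * A) = u1 * (2 ^+ M.-1 * (A * n%:R)) by ring.
  by rewrite ler_pM2l.
have lam0 : 0 < lam by exact: lt_le_trans lam_ge.
have rho_le : rho <= 2.
  have mw : (m + m)%:R * w <= 1 / 2.
    apply: le_trans nw; rewrite ler_wpM2r // ler_nat mM addnn -mul2n.
    by rewrite (leq_trans _ (ltnW mn)) // leq_mul2r orbT.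
  apply: le_trans (power_inv_le _ mw) _; first by rewrite w_ge0 /=; lra.
  by lra.
(* The maximizer of [c lam - c^2 (lam + 2 lam^2)], the second moment bound with [rho] replaced by
   2. *)
pose c := (2 * (1 + 2 * lam))^-1.
have c0 : 0 <= c by rewrite invr_ge0 mulr_ge0 // addr_ge0 // mulr_ge0 // ltW.
apply: le_trans (H _ c c0 _ _ _ tau_small); last 4 first.
- by lra.
- by [].
- exact: ltnW.
- exact: (power_ge_half w_ge0 nw (leq_subr _ _) n0).
rewrite lee_fin.
have rl : c ^+ 2 * (lam + rho * lam ^+ 2) <= c ^+ 2 * (lam + 2 * lam ^+ 2).
  by rewrite ler_wpM2l ?sqr_ge0 // lerD2l ler_wpM2r ?sqr_ge0.
apply: (@le_trans _ _ (c * lam - c ^+ 2 * (lam + 2 * lam ^+ 2))); last first.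
  by rewrite lerD2l lerN2.
have l1 : 0 < 1 + 2 * lam by rewrite addr_gt0 // mulr_gt0.
have c1 : 0 < 1 + 2 * c3 by rewrite addr_gt0 // mulr_gt0.
have -> : c * lam - c ^+ 2 * (lam + 2 * lam ^+ 2) = lam / (4 * (1 + 2 * lam)).
  by rewrite /c; field; rewrite gt_eqF.
rewrite ler_pdivrMr ?mulr_gt0 // mulrAC ler_pdivlMr ?mulr_gt0 //.
by lra.
Qed.

End DegreeAsymptotics.

(** * From the degree bounds to moments and convergence in probability *)

Theorem theorem1p1 (R : realType) (M : nat) (hM : (2 <= M)%N)
    (W : set 'rV[R]_M) (hW : convex_body W)
    (d : nat -> measure_display) (T : forall n, measurableType (d n))
    (P : forall n, probability (T n) R)
    (xi : forall n, 'I_n -> {RV (P n) >-> borel_rV R M})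
    (unif_xi : forall n (i : 'I_n), uniform_on W (xi n i))
    (indep_xi : forall n, mutually_independent (xi n)) :
  (forall k : nat, (1 <= k)%N ->
    exists (c : R) (n0 : nat), 0 < c /\
      forall n : nat, (n0 <= n)%N ->
        ((c * (n%:R ^+ k / ln n%:R))%:E <=
         'E_(P n)[fun w => ((degree (point_set (xi n) w))%:R ^+ k)%R])%E) /\
  (forall t : R, 0 < t ->
    (fun n => P n [set w | (degree (point_set (xi n) w))%:R <= t])
      @ \oo --> 0%E).

Proof.
split=> [k _|t t0].
  have [D [n0 [D0 Dn]]] := degree_linear_prob hM hW.
  (* The degree is at least [n / 4] with probability at least [D], so the moment is at least
     [D (n / 4)^k]. The second threshold ensures [n >= e], so that dividing by [ln n >= 1] only
     lowers the bound. *)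
  exists (D / 4 ^+ k), (maxn n0 (Num.truncn (expR 1 : R)).+1); split.
    by rewrite divr_gt0 // exprn_gt0.
  move=> n; rewrite geq_max => /andP[n0n en].
  have ln1 : 1 <= ln n%:R :> R.
    rewrite -[leLHS]expRK ler_ln ?posrE ?expR_gt0 //; last first.
      by rewrite ltr0n; exact: leq_trans en.
    by apply: le_trans (ltW (truncnS_gt _)) _; rewrite ler_nat.
  have := Dn n n0n _ _ _ _ (unif_xi n) (indep_xi n).
  set A := [set w | _] => DA.
  have mA : measurable A.
    rewrite /A [X in measurable X](_ : _ =
        [set w | ((n + 3) %/ 4 <= degree (point_set (xi n) w))%N]).
      exact: measurable_degree_ge.
    by apply/seteqP; split => w /=; lia.
  have a0 : 0 <= (n%:R / 4) ^+ k :> R by rewrite exprn_ge0 // divr_ge0.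
  rewrite unlock; apply: (@le_trans _ _ (((n%:R / 4) ^+ k)%:E * P n A)%E).
    apply: (@le_trans _ _ (((n%:R / 4) ^+ k)%:E * D%:E)%E).
      rewrite -EFinM lee_fin expr_div_n.
      have -> : D / 4 ^+ k * (n%:R ^+ k / ln n%:R) =
        n%:R ^+ k / 4 ^+ k * D / ln n%:R by ring.
      rewrite ler_pdivrMr ?(lt_le_trans ltr01) // ler_peMr //.
      by rewrite mulr_ge0 ?(ltW D0) // divr_ge0 ?exprn_ge0.
    by apply: lee_pmul => //; rewrite lee_fin // ltW.
  apply: integral_ge_indic => // w; rewrite lee_fin ?exprn_ge0 // => Aw.
  apply: lerXn2r; rewrite ?nnegrE ?divr_ge0 //.
  by rewrite ler_pdivrMr // mulrC -natrM ler_nat.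
(* The degree is an integer, so [degree <= t] is the complement of [floor(t) + 1 <= degree], and its
   probability is squeezed between 0 and [B / n]. *)
have [B [n0 Bn]] := degree_ge_prob hM hW (Num.truncn t).+1.
apply: (@squeeze_cvge _ _ _ _ (cst 0%E) _ (fun n => (B / n%:R)%:E)).
- near=> n; rewrite measure_ge0 /=.
  have n0n : (n0 <= n)%N by near: n; exact: nbhs_infty_ge.
  have := Bn n n0n _ _ _ _ (unif_xi n) (indep_xi n).
  set A := [set w | _] => BA.
  have mA : measurable A by exact: measurable_degree_ge.
  rewrite (_ : [set w | _] = ~` A); last first.
    apply/seteqP; split => w; rewrite /A /= -(truncn_ge_nat _ (ltW t0)).
      by move=> dt; apply/negP; rewrite -leqNgt.
    by move=> /negP; rewrite -leqNgt.
  rewrite probability_setC // leeBlDr ?fin_num_measure //.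
  apply: (@le_trans _ _ ((B / n%:R)%:E + (1 - B / n%:R)%:E)%E).
    by rewrite -EFinD lee_fin; lra.
  by rewrite leeD2l.
- exact: cvg_cst.
- apply: cvg_EFin; first exact: nearW.
  rewrite -(mulr0 B); apply: cvgMl_tmp; apply/gtr0_cvgV0.
    by near=> n; rewrite ltr0n; near: n; exact: nbhs_infty_gt.
  by apply/cvgrnyP.
Unshelve. all: by end_near.
Qed.
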